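(* Let $n\ge 2$ and let $\mathbb{T}^n=\mathbb{R}^n/\mathbb{Z}^n$ be the flat torus with volume form $\mu$. Let $a,b,c\ge 0$ be constants with at least two of them nonzero, and equip $\mathrm{Diff}(\mathbb{T}^n)$ with the right-invariant metric given at the identity by $$\langle\!\langle u,v\rangle\!\rangle=a\int_{\mathbb{T}^n}\langle u,v\rangle\,d\mu+b\int_{\mathbb{T}^n}\delta u^\flat\cdot\delta v^\flat\,d\mu+c\int_{\mathbb{T}^n}\langle du^\flat,dv^\flat\rangle\,d\mu .$$ Then the sectional curvature takes on both signs: there exist $u,v$ with $\langle\!\langle R(u,v)v,u\rangle\!\rangle>0$ and $u,v$ with $\langle\!\langle R(u,v)v,u\rangle\!\rangle<0$.
   Context: $d$ is the exterior derivative, $\delta$ its formal $L^2$-adjoint, $\flat$ the index-lowering isomorphism of the flat metric; $R$ is the curvature tensor of the Levi-Civita connection of the right-invariant metric at the identity. When $a=0$ the metric is degenerate on constant (harmonic) vector fields and is understood as a metric on the quotient $\mathrm{Diff}(\mathbb{T}^n)/\mathbb{T}^n$, i.e. modulo harmonic fields. *)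

(* Defs.v *)
From HB Require Import structures.
From Stdlib Require Import ClassicalEpsilon.
From mathcomp Require Import all_boot all_order all_algebra.
From mathcomp Require Import all_classical all_reals all_analysis.
Set Implicit Arguments. Unset Strict Implicit. Unset Printing Implicit Defensive.
Import Order.TTheory GRing.Theory Num.Theory.
Import numFieldNormedType.Exports.
Local Open Scope classical_set_scope.
Local Open Scope ring_scope.

(* Points of R^n (the universal cover of T^n = R^n/Z^n) are row vectors
   'rV[R]_n; a vector field on T^n is a Z^n-periodic smooth map
   'rV[R]_n -> 'rV[R]_n. *)

Definition vf (R : realType) (n : nat) := 'rV[R]_n -> 'rV[R]_n.

Definition evec (R : realType) (n : nat) (i : 'I_n) : 'rV[R]_n := delta_mx 0 i.

Definition pderiv (R : realType) (n : nat) (i : 'I_n) (f : 'rV[R]_n -> R)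
  : 'rV[R]_n -> R := fun x => 'D_(evec R i) f x.

Fixpoint iter_pderiv (R : realType) (n : nat) (s : seq 'I_n)
  (f : 'rV[R]_n -> R) : 'rV[R]_n -> R :=
  match s with
  | [::] => f
  | i :: s' => pderiv i (iter_pderiv s' f)
  end.

Definition smooth_fun (R : realType) (n : nat) (f : 'rV[R]_n -> R) : Prop :=
  forall s : seq 'I_n, continuous (iter_pderiv s f) /\
    (forall (i : 'I_n) (x : 'rV[R]_n), derivable (iter_pderiv s f) x (evec R i)).

Definition periodic_fun (R : realType) (n : nat) (f : 'rV[R]_n -> R) : Prop :=
  forall (x : 'rV[R]_n) (i : 'I_n), f (x + evec R i) = f x.

Definition vcomp (R : realType) (n : nat) (u : vf R n) (j : 'I_n)
  : 'rV[R]_n -> R := fun x => u x 0 j.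

Definition is_vf (R : realType) (n : nat) (u : vf R n) : Prop :=
  forall j : 'I_n, smooth_fun (vcomp u j) /\ periodic_fun (vcomp u j).

(* Integration over T^n with respect to mu (Lebesgue measure on the
   fundamental domain [0,1]^n), as an iterated integral. *)
Definition setcoord (R : realType) (n : nat) (x : 'rV[R]_n) (i : 'I_n) (t : R)
  : 'rV[R]_n := x + (t - x 0 i) *: evec R i.

Definition int_coord (R : realType) (n : nat) (i : 'I_n) (f : 'rV[R]_n -> R)
  : 'rV[R]_n -> R :=
  fun x => Rintegral (@lebesgue_measure R) `[0%R, 1%R]
             (fun t => f (setcoord x i t)).

Definition torus_int (R : realType) (n : nat) (f : 'rV[R]_n -> R) : R :=
  (foldr (fun i g => int_coord i g) f (enum 'I_n)) 0.

Definition dotf (R : realType) (n : nat) (u v : vf R n) : 'rV[R]_n -> R :=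
  fun x => \sum_(j < n) u x 0 j * v x 0 j.

Definition codiff (R : realType) (n : nat) (u : vf R n) : 'rV[R]_n -> R :=
  fun x => - \sum_(i < n) pderiv i (vcomp u i) x.

Definition dflat (R : realType) (n : nat) (u : vf R n) (i j : 'I_n)
  : 'rV[R]_n -> R :=
  fun x => pderiv i (vcomp u j) x - pderiv j (vcomp u i) x.

Definition dot2 (R : realType) (n : nat) (u v : vf R n) : 'rV[R]_n -> R :=
  fun x => \sum_(i < n) \sum_(j < n | (i < j)%N) dflat u i j x * dflat v i j x.

Definition abc_metric (R : realType) (n : nat) (a b c : R) (u v : vf R n) : R :=
  a * torus_int (dotf u v)
  + b * torus_int (fun x => codiff u x * codiff v x)
  + c * torus_int (dot2 u v).

Definition vfbracket (R : realType) (n : nat) (u v : vf R n) : vf R n :=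
  fun x => \row_(j < n) \sum_(i < n)
     (u x 0 i * pderiv i (vcomp v j) x - v x 0 i * pderiv i (vcomp u j) x).

(* Lie algebra bracket of Diff(T^n) (right-invariant fields): ad_u v = -[u,v] *)
Definition liebr (R : realType) (n : nat) (u v : vf R n) : vf R n :=
  fun x => - vfbracket u v x.

(* Tangent space at the identity of the Lie group on which the metric is a
   genuine Riemannian metric: for a > 0 this is Diff(T^n) and its Lie algebra
   is all smooth fields; for a = 0 the metric lives on the quotient
   T^n \ Diff(T^n), which is identified (isometrically, right-Diff-equivariantly)
   with the subgroup Diff_0 = {eta | eta(0) = 0}, whose Lie algebra is the
   fields vanishing at 0 (= vector fields modulo constant/harmonic fields). *)
Definition in_liealg (R : realType) (n : nat) (a : R) (u : vf R n) : Prop :=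
  is_vf u /\ (a = 0 -> u 0 = 0).

Definition koszul (R : realType) (n : nat) (a b c : R) (u v z : vf R n) : R :=
  (abc_metric a b c (liebr u v) z - abc_metric a b c (liebr v z) u
   + abc_metric a b c (liebr z u) v) / 2.

(* Levi-Civita connection at the identity: the unique field in the Lie
   algebra representing the Koszul form *)
Definition nabla (R : realType) (n : nat) (a b c : R) (u v : vf R n) : vf R n :=
  epsilon (inhabits (fun _ => 0))
    (fun w : vf R n => in_liealg a w /\
       forall z, in_liealg a z -> abc_metric a b c w z = koszul a b c u v z).

Definition curv (R : realType) (n : nat) (a b c : R) (u v w : vf R n) : vf R n :=
  fun x => nabla a b c u (nabla a b c v w) x - nabla a b c v (nabla a b c u w) x
           - nabla a b c (liebr u v) w x.

Definition sec_num (R : realType) (n : nat) (a b c : R) (u v : vf R n) : R :=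
  abc_metric a b c (curv a b c u v v) u.

(* Main.v *)
Require Import Defs.
From Stdlib Require Import ClassicalEpsilon.
From mathcomp Require Import all_boot all_order all_algebra.
From mathcomp Require Import all_classical all_reals all_analysis.
From mathcomp Require Import ring lra.
Set Implicit Arguments. Unset Strict Implicit. Unset Printing Implicit Defensive.
Import Order.TTheory GRing.Theory Num.Theory.
Import numFieldNormedType.Exports.
Local Open Scope classical_set_scope.
Local Open Scope ring_scope.

(* The curvature is computed on fields [f e_0 + g e_1] whose components depend
   on the coordinate [x_0] only.  On them the inertia operator of the metric is
   [a - b d^2] on [f] and [a - c d^2] on [g], with [d] the derivative in [x_0],
   so that for trigonometric polynomials [f] and [g] the covariant derivative is
   found by dividing Fourier coefficients.  It is the only representative of the
   Koszul form because the metric is definite on the Lie algebra; for [a = 0]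
   this is Hodge theory: a field with vanishing divergence and curl is constant.

   For [u = (t + e cos 2 theta) e_0] and [v = sin theta e_1], where
   [theta = 2 pi x_0], the curvature is a quadratic form in [(t, e)] without
   [t^2] term, since constant fields are Killing.  If [a > 0], its [t e] term is
   positive, so both signs occur at [t = 1] for small [e].  If [a = 0], its [e^2]
   term is [- 3/4 c (2 pi)^4], and the positive sign is found among the fields
   [f e_0], where the metric is that of the Hunter-Saxton equation, of positive
   constant curvature. *)

(** * Integrals over the unit interval *)

(** [nabla] is an [epsilon] choice, so its value means something only once a representative of the
    Koszul form is exhibited. Paired with [u], the curvature sees the three outer covariant
    derivatives only through their Koszul forms: for them existence is enough, and closed formulas
    are needed just for [nabla v v] and [nabla u v]. Existence is why the fields are trigonometric
    polynomials: that class is stable under products, derivatives and inversion of the inertia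
    operator.

    A representative must agree with the Koszul form against every smooth [z], which depends on all
    coordinates. Hence integration by parts on the whole torus, for an iterated integral and for
    functions known only through directional derivatives; it rests on translation invariance and on
    difference quotients under the integral sign.

    For [a = 0] the Lie algebra consists of fields vanishing at the origin, while the inertia
    operators annihilate constants. So right-hand sides must have mean zero, solutions are corrected
    by a constant, and the chosen fields get a constant term where they would not vanish at the
    origin. *)

Section UnitInterval.
Context {R : realType}.
Implicit Types g G : R -> R.

Local Notation int01 g := (Rintegral (@lebesgue_measure R) `[0%R, 1%R] g).

Lemma continuous_integrable_itv g (x y : R) : continuous g ->
  (@lebesgue_measure R).-integrable `[x, y] (EFin \o g).
Proof.
move=> cg; apply: continuous_compact_integrable; first exact: segment_compact.
exact: continuous_subspaceT.
Qed.

Lemma int01_cst (r : R) : int01 (fun _ => r) = r.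
Proof.
rewrite Rintegral_cst//= (_ : lebesgue_measure _ = 1%:E) ?mulr1//.
by have /= -> := @lebesgue_measure_itv R `[0, 1]; rewrite lte_fin ltr01 oppr0 adde0.
Qed.

(** Compactness of [0, 1] makes the closeness of [K q t] to [K p t] uniform in [t] for [q] near [p],
    as in the tube lemma, so the parameter may range over any topological space. *)
Lemma int01_param_continuous (T : topologicalType) (K : T -> R -> R) :
  continuous (fun p : T * R => K p.1 p.2) ->
  continuous (fun p => int01 (K p)).
Proof.
move=> cK.
have cKp p : continuous (K p).
  by move=> t; apply: (cvg_comp2 (cvg_cst p) (@cvg_id _ _) (cK (p, t))).
move=> p; apply/cvgrPdist_lt => e e0.
have /compact_near_coveringP nc : compact `[0 : R, 1] by exact: segment_compact.
have H : \forall q \near p, `[0, 1] `<=` (fun t => `|K p t - K q t| < e / 2).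
  apply: nc => t _.
  have e4 : 0 < e / 4 by rewrite divr_gt0.
  have /cvgrPdist_lt/(_ _ e4) H1 := cKp p t.
  have /cvgrPdist_lt/(_ _ e4) H2 := cK (p, t).
  case: H2 => -[A B] [/= Ap Bt] AB.
  exists (B `&` [set s | `|K p t - K p s| < e / 4], A).
    by split=> //; apply: filterI.
  move=> [s q] /= [[Bs Ks] Aq].
  have := AB (q, s) (conj Aq Bs) => /= Kqs.
  have -> : K p s - K q s = (K p t - K q s) - (K p t - K p s) by ring.
  rewrite (le_lt_trans (ler_normB _ _))//.
  by rewrite (_ : e / 2 = e / 4 + e / 4) ?ltrD//; field.
near=> q.
have Hq : `[0, 1] `<=` (fun t => `|K p t - K q t| < e / 2) by near: q.
have cpq : continuous (fun t => K p t - K q t).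
  by move=> t; apply: cvgB; exact: cKp.
have cn : continuous (fun t => `|K p t - K q t|).
  by move=> t; apply: (@cvg_norm _ _ _ _ _ _ _ (cpq t)).
rewrite -RintegralB//; try exact: continuous_integrable_itv.
(* The uniform bound [e / 2] survives integration only as a weak inequality; the halving restores
   strictness. *)
apply: (@le_lt_trans _ _ (e / 2)); last by rewrite ltr_pdivrMr// ltr_pMr// ltr1n.
apply: le_trans.
  apply: le_normr_Rintegral => //; exact: continuous_integrable_itv.
rewrite -[leRHS]int01_cst; apply: le_Rintegral => //.
- exact: continuous_integrable_itv.
- by apply: continuous_integrable_itv; exact: cst_continuous.
- by move=> t /Hq /ltW.
Unshelve. all: by end_near.
Qed.

(** The integral from [a] is differentiated only strictly to the right of [a], so each use starts it
    far enough to the left. *)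
Lemma continuous_primitive g (a : R) : continuous g ->
  exists G : R -> R, forall x : R, a < x -> is_derive x 1 G (g x).
Proof.
move=> cg; exists (fun x => \int[@lebesgue_measure R]_(t in `[a, x]) g t) => x ax.
have [] := @continuous_FTC1_closed R g a x (x + 1) _ _ ax (cg x).
- by rewrite ltrDl.
- exact: continuous_integrable_itv.
- by move=> dG eG; apply: (DeriveDef dG); rewrite -derive1E; exact: eG.
Qed.

Lemma int01_FTC g G : continuous g ->
  (forall x : R, 0 <= x <= 1 -> is_derive x 1 G (g x)) ->
  int01 g = G 1 - G 0.
Proof.
move=> cg dG; have cG x : 0 <= x <= 1 -> {for x, continuous G}.
  move=> /dG[dx _]; apply: differentiable_continuous.
  by apply/derivable1_diffP.
rewrite /Rintegral (@continuous_FTC2 _ g G 0 1)//=.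
- exact: continuous_subspaceT.
- split.
  + by move=> x /[!in_itv]/= /andP[x0 x1]; have [] := dG x; rewrite ?ltW.
  + by apply: cvg_at_right_filter; apply: cG; rewrite lexx ler01.
  + by apply: cvg_at_left_filter; apply: cG; rewrite lexx ler01.
- move=> x /[!in_itv]/= /andP[x0 x1]; rewrite derive1E.
  by have [] := dG x; rewrite ?ltW.
Qed.

Lemma is_derive_within g G (x y : R) :
  (forall t : R, x <= t <= y -> is_derive t 1 G (g t)) ->
  {within `[x, y], continuous G}.
Proof.
move=> dG; apply: continuous_in_subspaceT => t.
rewrite inE/= in_itv/= => /dG[dt _]; apply: differentiable_continuous.
by apply/derivable1_diffP.
Qed.

(** The integral of [g] over [[s, s + 1]] has derivative [g (s + 1) - g s = 0] in [s], hence is the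
    same at [s = h] and [s = 0]. *)
Lemma int01_shift g (h : R) : continuous g -> (forall t, g (t + 1) = g t) ->
  int01 (fun t => g (t + h)) = int01 g.
Proof.
(* This base point lies to the left of both [[0, 1]] and [[h, 1 + h]], whatever the sign of [h]. *)
move=> cg pg; have [G dG] := @continuous_primitive g (- `|h| - 1) cg.
have nh := normr_ge0 h.
have ah : - `|h| <= h by rewrite lerNl -normrN ler_norm.
have [{}dG dGs] : (forall x : R, - `|h| <= x -> is_derive x 1 G (g x)) /\
   forall x k : R, - `|h| <= x + k -> is_derive x 1 (fun t => G (t + k)) (g (x + k)).
  have D x : - `|h| <= x -> is_derive x 1 G (g x) by move=> hx; apply: dG; lra.
  split=> // x k hx.
  have := @is_derive1_comp _ G (fun t => t + k) x (g (x + k)) 1.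
  rewrite mulr1; apply; first exact: D.
  have := @is_deriveD R R _ id (cst k) x 1 1 0 (is_derive_id _ _) (is_derive_cst _ _ _).
  by rewrite addr0.
have -> : int01 (fun t => g (t + h)) = G (1 + h) - G h.
  rewrite -[X in _ - G X]add0r.
  apply: (@int01_FTC (fun t => g (t + h)) (fun t => G (t + h))).
    move=> t; apply: (@continuous_comp _ _ _ (fun t => t + h)); last exact: cg.
    by apply: cvgD; [exact: cvg_id|exact: cvg_cst].
  by move=> x /andP[x0 x1]; apply: dGs; lra.
have -> : int01 g = G 1 - G 0.
  by apply: int01_FTC => // x /andP[x0 x1]; apply: dG; lra.
pose D s := G (s + 1) - G s.
have dD s : - `|h| <= s -> is_derive s 1 D 0.
  move=> hs; have -> : 0 = g (s + 1) - g s by rewrite pg subrr.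
  by apply: is_deriveB; [apply: dGs; lra|apply: dG].
suff DD x y : - `|h| <= x -> x <= y -> D x = D y.
  transitivity (D h); first by rewrite /D addrC [1 + h]addrC addrC.
  transitivity (D 0); last by rewrite /D add0r.
  by case: (leP h 0) => h0; [|apply/esym]; apply: DD => //; lra.
move=> hx xy; apply/eqP; rewrite eq_sym -subr_eq0.
have [||c _ ->] := @MVT_segment R D (cst 0) x y xy.
- by move=> t /[!in_itv]/= /andP[xt ty]; apply: dD; lra.
- by apply: (@is_derive_within (cst 0)) => t /andP[xt ty]; apply: dD; lra.
- by rewrite mul0r.
Qed.

(** If [g 0] were positive, a primitive would increase strictly near [0] and decrease nowhere. The
    endpoint alone is enough, since translations of the torus later bring any point there. *)
Lemma int01_eq0 g : continuous g -> (forall t, 0 <= g t) -> int01 g = 0 ->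
  g 0 = 0.
Proof.
move=> cg g0 ig; apply/eqP/negP => /negP g00.
have {}g00 : 0 < g 0 by rewrite lt_neqAle eq_sym g00 g0.
have [G dG] := @continuous_primitive g (- 1) cg.
have {}dG (x : R) : 0 <= x -> is_derive x 1 G (g x) by move=> x0; apply: dG; lra.
have {}ig : G 1 - G 0 = 0.
  rewrite -[RHS]ig; symmetry; apply: (@int01_FTC g G cg) => x /andP[x0 _]; exact: dG.
have incG x y : 0 <= x -> x < y ->
    exists2 c, x < c < y & G y - G x = g c * (y - x).
  move=> x0 xy; have [||c + e] := @MVT R G g x y xy; last first.
  - by rewrite in_itv/= => xcy; exists c.
  - by apply: (@is_derive_within g) => t /andP[xt ty]; apply: dG; lra.
  - by move=> t /[!in_itv]/= /andP[xt ty]; apply: dG; lra.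
have /cvgrPdist_lt/(_ _ g00)[/= d d0 Hd] := cg 0.
(* Below [d], so that the mean value point lies where [g] is positive; below [1], so that an
   interval [[t, 1]] remains. *)
pose t := Num.min (d / 2) (1 / 2).
have t0 : 0 < t by rewrite lt_min !divr_gt0.
have td : t <= d / 2 by rewrite ge_min lexx.
have t1 : t <= 1 / 2 by rewrite ge_min lexx orbT.
have [c /andP[c0 ct] ec] := incG 0 t (lexx _) t0.
have [c' _ ec'] : exists2 c, t < c < 1 & G 1 - G t = g c * (1 - t).
  by apply: incG; lra.
have gc : 0 < g c.
  have /= := Hd c; rewrite sub0r normrN gtr0_norm// => /(_ _).
  rewrite ltr_norml => /(_ _)/andP[]; last by move=> _; rewrite gtrBl.
  by lra.
have : 0 < g c * (t - 0) by rewrite mulr_gt0// subr0.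
have : 0 <= g c' * (1 - t) by rewrite mulr_ge0 ?g0//; lra.
by rewrite -ec -ec'; lra.
Qed.

End UnitInterval.

(** * The iterated integral over the torus *)

Section Continuity.
Context {R : realType}.

Lemma continuous_add (T : topologicalType) (V : normedModType R) (f g : T -> V) :
  continuous f -> continuous g -> continuous (fun x => f x + g x).
Proof. by move=> cf cg x; apply: cvgD; [exact: cf|exact: cg]. Qed.

Lemma continuous_opp (T : topologicalType) (V : normedModType R) (f : T -> V) :
  continuous f -> continuous (fun x => - f x).
Proof. by move=> cf x; apply: cvgN; exact: cf. Qed.

Lemma continuous_mul (T : topologicalType) (f g : T -> R) :
  continuous f -> continuous g -> continuous (fun x => f x * g x).
Proof. by move=> cf cg x; apply: cvgM; [exact: cf|exact: cg]. Qed.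

Lemma continuous_scale (T : topologicalType) (V : normedModType R) (f : T -> R) (v : V) :
  continuous f -> continuous (fun x => f x *: v).
Proof. by move=> cf x; apply: cvgZr_tmp; exact: cf. Qed.

Lemma continuous_compose (T U W : topologicalType) (f : T -> U) (g : U -> W) :
  continuous f -> continuous g -> continuous (fun x => g (f x)).
Proof. by move=> cf cg x; apply: continuous_comp; [exact: cf|exact: cg]. Qed.

Lemma continuous_pair (T U W : topologicalType) (f : T -> U) (g : T -> W) :
  continuous f -> continuous g -> continuous (fun x => (f x, g x)).
Proof. by move=> cf cg x; apply: cvg_pair; [exact: cf|exact: cg]. Qed.

Lemma continuous_id (T : topologicalType) : continuous (fun x : T => x).
Proof. by move=> x; exact: cvg_id. Qed.

Lemma continuous_fst (T U : topologicalType) : continuous (@fst T U).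
Proof. by move=> x; exact: cvg_fst. Qed.

Lemma continuous_snd (T U : topologicalType) : continuous (@snd T U).
Proof. by move=> x; exact: cvg_snd. Qed.

End Continuity.

Section TorusIntegral.
Context {R : realType} {n : nat}.
Implicit Types (f g F : 'rV[R]_n -> R) (x y : 'rV[R]_n) (i j : 'I_n).

Local Notation int01 g := (Rintegral (@lebesgue_measure R) `[0%R, 1%R] g).
Local Notation itint s f := (foldr (fun i g => int_coord i g) f s).
Local Notation shift h j := (fun x : 'rV[R]_n => x + h *: evec R j).

Lemma shift_continuous (h : R) j : continuous (shift h j).
Proof.
by apply: continuous_add; [exact: continuous_id|exact: cst_continuous].
Qed.

Lemma int_coord_param_continuous (T : topologicalType) i
    (K : T -> 'rV[R]_n -> R) :
  continuous (fun p : T * 'rV[R]_n => K p.1 p.2) ->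
  continuous (fun p : T * 'rV[R]_n => int_coord i (K p.1) p.2).
Proof.
move=> cK; apply: (@int01_param_continuous _ _
  (fun p t => K p.1 (setcoord p.2 i t))).
have c1 : continuous (fun q : (T * 'rV[R]_n) * R => q.1).
  exact: continuous_fst.
have c12 : continuous (fun q : (T * 'rV[R]_n) * R => q.1.2).
  exact: (continuous_compose c1 (@continuous_snd _ _)).
apply: (continuous_compose (f := fun q : (T * 'rV[R]_n) * R =>
  (q.1.1, setcoord q.1.2 i q.2)) _ cK).
apply: continuous_pair.
  exact: (continuous_compose c1 (@continuous_fst _ _)).
apply: continuous_add => //; apply: continuous_scale; apply: continuous_add.
  exact: continuous_snd.
apply: continuous_opp.
exact: (continuous_compose c12 (g := fun M : 'rV[R]_n => M 0 i)
  (@coord_continuous _ _ _ _ _)).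
Qed.

Lemma itint_param_continuous (T : topologicalType) s
    (K : T -> 'rV[R]_n -> R) :
  continuous (fun p : T * 'rV[R]_n => K p.1 p.2) ->
  continuous (fun p : T * 'rV[R]_n => itint s (K p.1) p.2).
Proof.
move=> cK; elim: s => [//|i s IH] /=.
exact: (@int_coord_param_continuous T i (fun p => itint s (K p))).
Qed.

(** Used with the step of a difference quotient as parameter, to let that step tend to [0] under the
    integral. *)
Lemma torus_int_param_continuous (T : topologicalType)
    (K : T -> 'rV[R]_n -> R) :
  continuous (fun p : T * 'rV[R]_n => K p.1 p.2) ->
  continuous (fun p => torus_int (K p)).
Proof.
move=> /(@itint_param_continuous _ (enum 'I_n)) cK.
have c0 : continuous (fun p : T => (p, 0 : 'rV[R]_n)).
  by apply: continuous_pair; [exact: continuous_id|exact: cst_continuous].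
exact: (continuous_compose c0 cK).
Qed.

Lemma itint_continuous s f : continuous f -> continuous (itint s f).
Proof.
move=> cf.
have cK : continuous (fun p : R * 'rV[R]_n => (fun _ : R => f) p.1 p.2).
  by apply: continuous_compose cf; exact: continuous_snd.
have c0 : continuous (fun x : 'rV[R]_n => (0 : R, x)).
  by apply: continuous_pair; [exact: cst_continuous|exact: continuous_id].
exact: (continuous_compose c0 (@itint_param_continuous _ s _ cK)).
Qed.

Lemma continuous_setcoord f i x : continuous f ->
  continuous (fun t => f (setcoord x i t)).
Proof.
move=> cf; apply: continuous_compose cf; apply: continuous_add.
  exact: cst_continuous.
apply: continuous_scale; apply: continuous_add; first exact: continuous_id.
exact: cst_continuous.
Qed.

Lemma itint_linear s (r : R) f g : continuous f -> continuous g ->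
  itint s (fun x => r * f x + g x) = (fun x => r * itint s f x + itint s g x).
Proof.
move=> cf cg; elim: s => [//|i s /= ->]; apply/funext => x.
rewrite /int_coord.
have If h : continuous h -> (@lebesgue_measure R).-integrable `[0, 1]
    (EFin \o (fun t => itint s h (setcoord x i t))).
  move=> ch; apply: continuous_integrable_itv; apply: continuous_setcoord.
  exact: itint_continuous.
rewrite RintegralD ?RintegralZl//; try exact: If.
have c := @continuous_setcoord _ i x (@itint_continuous s _ cf).
apply: continuous_integrable_itv.
by apply: continuous_mul; [exact: cst_continuous|exact: c].
Qed.

Lemma torus_int_linear (r : R) f g : continuous f -> continuous g ->
  torus_int (fun x => r * f x + g x) = r * torus_int f + torus_int g.
Proof. by move=> cf cg; rewrite /torus_int itint_linear. Qed.

Lemma itint_cst s (r : R) : itint s (fun _ => r) = (fun _ => r).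
Proof.
by elim: s => [//|i s /= ->]; apply/funext => x; rewrite /int_coord int01_cst.
Qed.

Lemma torus_int_cst (r : R) : torus_int (fun _ : 'rV[R]_n => r) = r.
Proof. by rewrite /torus_int itint_cst. Qed.

Lemma torus_intD f g : continuous f -> continuous g ->
  torus_int (fun x => f x + g x) = torus_int f + torus_int g.
Proof.
move=> cf cg; rewrite -[torus_int f]mul1r -torus_int_linear//.
by congr torus_int; apply/funext => x; rewrite mul1r.
Qed.

Lemma torus_intZ (r : R) f : continuous f ->
  torus_int (fun x => r * f x) = r * torus_int f.
Proof.
move=> cf; rewrite -[RHS]addr0 -[X in _ + X]torus_int_cst -torus_int_linear//.
  by congr torus_int; apply/funext => x; rewrite addr0.
exact: cst_continuous.
Qed.

Lemma torus_intB f g : continuous f -> continuous g ->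
  torus_int (fun x => f x - g x) = torus_int f - torus_int g.
Proof.
move=> cf cg; rewrite -[in RHS]mulN1r addrC -torus_int_linear//.
by congr torus_int; apply/funext => x; rewrite mulN1r addrC.
Qed.

Lemma itint_ge0 s f : (forall x, 0 <= f x) -> forall x, 0 <= itint s f x.
Proof.
by move=> f0; elim: s => [//|i s IH] x /=; apply: Rintegral_ge0 => t _.
Qed.

Lemma torus_int_ge0 f : (forall x, 0 <= f x) -> 0 <= torus_int f.
Proof. by move=> f0; exact: itint_ge0. Qed.

Lemma torus_int_eq0_at0 f : continuous f -> (forall x, 0 <= f x) ->
  torus_int f = 0 -> f 0 = 0.
Proof.
move=> cf f0; rewrite /torus_int; elim: (enum _) => [//|i s IH] /= H.
apply: IH.
(* The base point lies on each coordinate line at parameter [0], so the one-variable statement at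
   the left endpoint peels off one coordinate at a time. *)
have -> : 0 = setcoord 0 i 0 :> 'rV[R]_n.
  by rewrite /setcoord mxE subrr scale0r addr0.
apply: (@int01_eq0 _ (fun t => itint s f (setcoord 0 i t))) => //.
- by apply: continuous_setcoord; exact: itint_continuous.
- by move=> t; exact: itint_ge0.
Qed.

Lemma int_coord_shift_neq (h : R) i j f : i != j ->
  int_coord i (f \o shift h j) = int_coord i f \o shift h j.
Proof.
move=> ij; apply/funext => x; rewrite /int_coord /=.
congr Rintegral; apply/funext => t; rewrite /setcoord /=; congr f.
by rewrite !mxE eqxx (negbTE ij) mulr0 addr0 addrAC.
Qed.

Lemma int_coord_indep (h : R) j f : int_coord j f \o shift h j = int_coord j f.
Proof.
apply/funext => x; rewrite /int_coord /=; congr Rintegral; apply/funext => t.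
rewrite /setcoord; congr f; rewrite !mxE !eqxx mulr1 -addrA -scalerDl.
by congr (_ + _ *: _); ring.
Qed.

Lemma int_coord_shift (h : R) i j f : continuous f ->
  (forall x, f (x + evec R j) = f x) ->
  int_coord i (f \o shift h j) = int_coord i f \o shift h j.
Proof.
move=> cf pf; have [->|ij] := eqVneq i j; last first.
  by rewrite int_coord_shift_neq.
rewrite int_coord_indep; apply/funext => x; rewrite /int_coord.
rewrite -(@int01_shift _ (fun t => f (setcoord x j t)) h).
- congr Rintegral; apply/funext => t /=; congr f.
  by rewrite /setcoord -addrA -scalerDl; congr (_ + _ *: _); ring.
- exact: continuous_setcoord.
- move=> t; rewrite -[RHS]pf; congr f.
  rewrite /setcoord -[RHS]addrA -[X in _ = _ + (_ + X)]scale1r -scalerDl.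
  by congr (_ + _ *: _); ring.
Qed.

Lemma itint_shift s (h : R) j f : continuous f ->
  (forall x, f (x + evec R j) = f x) ->
  itint s (f \o shift h j) = itint s f \o shift h j.
Proof.
move=> cf pf; elim: s h => [//|i s IH] h /=.
rewrite IH int_coord_shift//; first exact: itint_continuous.
(* The induction hypothesis for the shift by [1] is the periodicity of the inner integral. *)
move=> x; have := IH 1.
have -> : f \o shift 1 j = f by apply/funext => y; rewrite /= scale1r pf.
by move=> /(congr1 (fun F => F x)) /=; rewrite scale1r => <-.
Qed.

Lemma itint_indep s (h : R) j f : j \in s -> itint s f \o shift h j = itint s f.
Proof.
elim: s => [//|i s IH]; rewrite inE /=.
have [->|ij /= js] := eqVneq j i; first by rewrite int_coord_indep.
by rewrite -int_coord_shift_neq 1?eq_sym// IH.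
Qed.

(** Periodicity lets the shift pass through all the integrations, and the one in coordinate [j]
    erases any dependence on that coordinate. *)
Lemma torus_int_shift (h : R) j f : continuous f -> periodic_fun f ->
  torus_int (f \o shift h j) = torus_int f.
Proof.
move=> cf pf; rewrite /torus_int itint_shift// itint_indep//.
by rewrite mem_enum.
Qed.

Lemma periodic_shift (h : R) j f : periodic_fun f -> periodic_fun (f \o shift h j).
Proof. by move=> pf x i /=; rewrite addrAC pf. Qed.

Lemma torus_int_translate y f : continuous f -> periodic_fun f ->
  torus_int (fun x => f (x + y)) = torus_int f.
Proof.
rewrite (row_sum_delta y); elim: (index_enum _) f => [|j s IH] f cf pf.
  by rewrite big_nil; congr torus_int; apply/funext => x; rewrite addr0.
rewrite -(torus_int_shift (y 0 j) j cf pf) -[RHS]IH; last 2 first.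
- by apply: continuous_compose cf; exact: shift_continuous.
- exact: periodic_shift.
congr torus_int; apply/funext => x /=; congr f.
by rewrite big_cons addrA addrAC.
Qed.

Lemma torus_int_eq0 f : continuous f -> periodic_fun f -> (forall x, 0 <= f x) ->
  torus_int f = 0 -> forall x, f x = 0.
Proof.
move=> cf pf f0 If x; rewrite -[x]add0r.
apply: (@torus_int_eq0_at0 (fun y => f (y + x))) => //.
- apply: continuous_compose cf; apply: continuous_add.
    exact: continuous_id.
  exact: cst_continuous.
- by rewrite torus_int_translate.
Qed.

Lemma is_derive_line F j x (t : R) : derivable F (x + t *: evec R j) (evec R j) ->
  is_derive t 1 (fun t => F (x + t *: evec R j)) (pderiv j F (x + t *: evec R j)).
Proof.
set y := x + t *: _ => dF.
have E : (fun h : R => h^-1 *: (((fun t => F (x + t *: evec R j)) \o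
    (fun z : R => z + t)) (h *: (1 : R)) - F (x + t *: evec R j))) =
    (fun h : R => h^-1 *: ((F \o +%R^~ y) (h *: evec R j) - F y)).
  apply/funext => h /=; congr (_ *: (F _ - _)).
  by rewrite /y [_ *: 1]mulr1 scalerDl addrCA.
by apply: DeriveDef; rewrite /derivable /pderiv /derive /= E.
Qed.

(* The difference quotient of [F] in direction [j], with its removable
   singularity at step [0] filled in. *)
Definition diffq j F (h : R) : 'rV[R]_n -> R :=
  fun x => int01 (fun s => pderiv j F (x + (s * h) *: evec R j)).

Lemma diffq0 j F : diffq j F 0 = pderiv j F.
Proof.
apply/funext => x; rewrite /diffq -[RHS]int01_cst; congr Rintegral.
by apply/funext => t; rewrite mulr0 scale0r addr0.
Qed.

Section DifferenceQuotient.
Context (j : 'I_n) (F : 'rV[R]_n -> R).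
Hypothesis dF : forall x, derivable F x (evec R j).
Hypothesis cdF : continuous (pderiv j F).

Lemma diffqE (h : R) x : h * diffq j F h x = F (x + h *: evec R j) - F x.
Proof.
have c : continuous (fun s : R => pderiv j F (x + (s * h) *: evec R j)).
  apply: continuous_compose cdF; apply: continuous_add.
    exact: cst_continuous.
  apply: continuous_scale; apply: continuous_mul; first exact: continuous_id.
  exact: cst_continuous.
rewrite /diffq -RintegralZl//; last exact: continuous_integrable_itv.
rewrite (_ : F (x + h *: _) - F x =
   F (x + (1 * h) *: evec R j) - F (x + (0 * h) *: evec R j)); last first.
  by rewrite mul1r mul0r scale0r addr0.
apply: (@int01_FTC _ _ (fun s => F (x + (s * h) *: evec R j))).
  by apply: continuous_mul; [exact: cst_continuous|exact: c].
move=> s _; rewrite [X in is_derive _ _ _ X]mulrC.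
apply: (@is_derive1_comp _ (fun t => F (x + t *: evec R j)) (fun s => s * h)).
  exact: is_derive_line.
have := @is_deriveM R R id (cst h) s 1 1 0 (is_derive_id _ _) (is_derive_cst _ _ _).
by rewrite scaler0 add0r [_ *: _]mulr1.
Qed.

Lemma diffq_continuous :
  continuous (fun p : R * 'rV[R]_n => diffq j F p.1 p.2).
Proof.
apply: (@int01_param_continuous _ _
  (fun (p : R * 'rV[R]_n) s => pderiv j F (p.2 + (s * p.1) *: evec R j))).
have c1 : continuous (fun q : (R * 'rV[R]_n) * R => q.1).
  exact: continuous_fst.
apply: continuous_compose cdF; apply: continuous_add.
  exact: (continuous_compose c1 (@continuous_snd _ _)).
apply: continuous_scale; apply: continuous_mul; first exact: continuous_snd.
exact: (continuous_compose c1 (@continuous_fst _ _)).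
Qed.

Lemma torus_int_mul_diffq g : continuous g ->
  continuous (fun h => torus_int (fun x => g x * diffq j F h x)).
Proof.
move=> cg; apply: torus_int_param_continuous.
apply: continuous_mul; last exact: diffq_continuous.
by apply: continuous_compose cg; exact: continuous_snd.
Qed.

Lemma diffq_continuous1 (h : R) : continuous (diffq j F h).
Proof.
have c0 : continuous (fun x : 'rV[R]_n => (h, x)).
  by apply: continuous_pair; [exact: cst_continuous|exact: continuous_id].
exact: (continuous_compose c0 diffq_continuous).
Qed.

End DifferenceQuotient.

(** Identities for difference quotients are obtained by cancelling a step [h != 0]; continuity in
    [h] carries them to the derivative at [h = 0]. *)
Lemma continuous_ext0 (p q : R -> R) : continuous p -> continuous q ->
  (forall h, h != 0 -> p h = q h) -> p 0 = q 0.
Proof.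
move=> cp cq pq.
have Hp : p h @[h --> 0^'] --> p 0 by apply: cvg_within_filter; exact: cp.
have Hq : q h @[h --> 0^'] --> q 0 by apply: cvg_within_filter; exact: cq.
apply: (cvg_unique _ Hp) => //.
apply: cvg_trans Hq; apply: near_eq_cvg.
by near=> h; rewrite pq//; near: h; exact: nbhs_dnbhs_neq.
Unshelve. all: by end_near.
Qed.

(** For [h != 0] the difference quotient integrates to zero by translation invariance; then [h]
    tends to [0]. The iterated integrals are never interchanged, wherever [j] stands among them. *)
Lemma torus_int_pderiv j F : continuous F -> periodic_fun F ->
  (forall x, derivable F x (evec R j)) -> continuous (pderiv j F) ->
  torus_int (pderiv j F) = 0.
Proof.
move=> cF pF dF cdF; rewrite -(diffq0 j F).
have E h : diffq j F h = (fun x => 1 * diffq j F h x).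
  by apply/funext => x; rewrite mul1r.
rewrite E; apply: (@continuous_ext0
  (fun h => torus_int (fun x => 1 * diffq j F h x)) (fun _ => 0)).
- by apply: torus_int_mul_diffq => //; exact: cst_continuous.
- exact: cst_continuous.
move=> h h0; apply/eqP; rewrite -E -(mulrI_eq0 _ (mulfI h0)) -torus_intZ; last first.
  exact: diffq_continuous1.
under eq_fun do rewrite diffqE//.
rewrite torus_intB//; last first.
  by apply: continuous_compose cF; exact: shift_continuous.
by rewrite (torus_int_shift h j cF pF) subrr.
Qed.

End TorusIntegral.

(** * Smooth functions on the torus *)

Section SmoothPeriodic.
Context {R : realType} {n : nat}.
Implicit Types (f g F : 'rV[R]_n -> R) (x y : 'rV[R]_n) (i j : 'I_n).

Local Notation shift h j := (fun x : 'rV[R]_n => x + h *: evec R j).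

Lemma iter_pderiv_rcons s i f :
  iter_pderiv (rcons s i) f = iter_pderiv s (pderiv i f).
Proof. by elim: s => [//|k s IH] /=; rewrite IH. Qed.

(** Spares formulas for iterated derivatives: it suffices to place the function in a class stable
    under single partial derivatives. *)
Lemma smooth_fun_coind (Q : ('rV[R]_n -> R) -> Prop) :
  (forall f, Q f -> continuous f /\
     forall i, (forall x, derivable f x (evec R i)) /\ Q (pderiv i f)) ->
  forall f, Q f -> smooth_fun f.
Proof.
move=> HQ f Qf s; have : Q (iter_pderiv s f).
  by elim: s => [//|i s IH] /=; have [_ /(_ i)[]] := HQ _ IH.
by move=> /HQ[cf df]; split=> // i; have [] := df i.
Qed.

Definition tfun f := smooth_fun f /\ periodic_fun f.

Lemma tfun_continuous f : tfun f -> continuous f.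
Proof. by case=> /(_ [::])[]. Qed.

Lemma tfun_derivable f i x : tfun f -> derivable f x (evec R i).
Proof. by case=> /(_ [::])[_ /(_ i x)]. Qed.

Lemma shift_quotient i j (h : R) f x :
  (fun t : R => t^-1 *: ((f \o shift h j \o +%R^~ x) (t *: evec R i) -
     (f \o shift h j) x)) =
  (fun t : R => t^-1 *: ((f \o +%R^~ (x + h *: evec R j)) (t *: evec R i) -
     f (x + h *: evec R j))).
Proof. by apply/funext => t /=; rewrite addrA. Qed.

Lemma pderiv_shift i j (h : R) f :
  pderiv i (f \o shift h j) = pderiv i f \o shift h j.
Proof.
by apply/funext => x; rewrite /pderiv /derive /= shift_quotient.
Qed.

Lemma shift1 j f : (fun x => f (x + evec R j)) = f \o shift 1 j.
Proof. by apply/funext => x /=; rewrite scale1r. Qed.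

Lemma tfun_pderiv i f : tfun f -> tfun (pderiv i f).
Proof.
case=> sf pf; split; first by move=> s; rewrite -iter_pderiv_rcons; exact: sf.
move=> x j; have := pderiv_shift i j 1 f.
rewrite -!shift1 => /(congr1 (fun F => F x)) /= <-.
by congr (pderiv i _ x); apply/funext => y; exact: pf.
Qed.

Lemma derivable_shift i j (h : R) f x :
  derivable f (x + h *: evec R j) (evec R i) ->
  derivable (f \o shift h j) x (evec R i).
Proof.
by rewrite /derivable shift_quotient.
Qed.

Lemma tfun_shift (h : R) j f : tfun f -> tfun (f \o shift h j).
Proof.
move=> tf; split; last by apply: periodic_shift; case: tf.
apply: (@smooth_fun_coind (fun g => exists2 f, tfun f & g = f \o shift h j)).
  move=> _ [g tg ->]; split.
    by apply: continuous_compose (tfun_continuous tg); exact: shift_continuous.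
  move=> i; split; first by move=> x; apply: derivable_shift; exact: tfun_derivable.
  by exists (pderiv i g); [exact: tfun_pderiv|exact: pderiv_shift].
by exists f.
Qed.

Lemma pderivD i f g : tfun f -> tfun g ->
  pderiv i (fun x => f x + g x) = (fun x => pderiv i f x + pderiv i g x).
Proof.
by move=> tf tg; apply/funext => x; apply: deriveD; exact: tfun_derivable.
Qed.

Lemma pderivM i f g : tfun f -> tfun g ->
  pderiv i (fun x => f x * g x) = (fun x => pderiv i f x * g x + f x * pderiv i g x).
Proof.
move=> tf tg; apply/funext => x.
rewrite [LHS](@deriveM _ _ f g); try exact: tfun_derivable.
by rewrite addrC [_ *: _]mulrC.
Qed.

Lemma pderiv_cst i (r : R) : pderiv i (fun _ : 'rV[R]_n => r) = (fun _ => 0).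
Proof. by apply/funext => x; exact: derive_cst. Qed.

Lemma tfun_cst (r : R) : tfun (fun _ => r).
Proof.
split=> [|//].
apply: (@smooth_fun_coind (fun g => exists r, g = fun _ => r)); last by exists r.
move=> _ [k ->]; split; first exact: cst_continuous.
by move=> i; split; [move=> x; exact: derivable_cst|exists 0; exact: pderiv_cst].
Qed.

(** A partial derivative of a product is a sum of products, so the class fed to [smooth_fun_coind]
    has to be closed under both operations. *)
Inductive talg : ('rV[R]_n -> R) -> Prop :=
| talg_base f : tfun f -> talg f
| talg_add f g : talg f -> talg g -> talg (fun x => f x + g x)
| talg_mul f g : talg f -> talg g -> talg (fun x => f x * g x).

Lemma talg_tfun f : talg f -> tfun f.
Proof.
move=> tf; split; last first.
  elim: tf => [h []//|h k _ ph _ pk|h k _ ph _ pk] x i; first by rewrite ph pk.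
  by rewrite ph pk.
apply: (@smooth_fun_coind talg) tf => {}f; elim=> [{}f tf||].
- split; first exact: tfun_continuous.
  move=> i; split; first by move=> x; exact: tfun_derivable.
  by apply: talg_base; exact: tfun_pderiv.
- move=> h k th [ch dh] tk [ck dk]; split; first exact: continuous_add.
  move=> i; have [dhi thi] := dh i; have [dki tki] := dk i; split.
    by move=> x; apply: derivableD.
  have -> : pderiv i (fun x => h x + k x) = fun x => pderiv i h x + pderiv i k x.
    by apply/funext => x; exact: deriveD.
  exact: talg_add.
- move=> h k th [ch dh] tk [ck dk]; split; first exact: continuous_mul.
  move=> i; have [dhi thi] := dh i; have [dki tki] := dk i; split.
    by move=> x; apply: derivableM.
  have -> : pderiv i (fun x => h x * k x) =
      fun x => h x * pderiv i k x + k x * pderiv i h x.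
    by apply/funext => x; exact: deriveM.
  by apply: talg_add; exact: talg_mul.
Qed.

Lemma tfunD f g : tfun f -> tfun g -> tfun (fun x => f x + g x).
Proof. by move=> tf tg; apply/talg_tfun/talg_add; exact: talg_base. Qed.

Lemma tfunM f g : tfun f -> tfun g -> tfun (fun x => f x * g x).
Proof. by move=> tf tg; apply/talg_tfun/talg_mul; exact: talg_base. Qed.

Lemma tfunN f : tfun f -> tfun (fun x => - f x).
Proof.
move=> tf; rewrite (_ : (fun x => _) = (fun x => -1 * f x)).
  by apply: tfunM => //; exact: tfun_cst.
by apply/funext => x; rewrite mulN1r.
Qed.

Lemma tfun_sum (I : Type) (s : seq I) (P : pred I) (f : I -> 'rV[R]_n -> R) :
  (forall k, tfun (f k)) -> tfun (fun x => \sum_(k <- s | P k) f k x).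
Proof.
move=> tf; elim: s => [|k s IH].
  by under eq_fun do rewrite big_nil; exact: tfun_cst.
under eq_fun do rewrite big_cons; case: (P k) => //; exact: tfunD.
Qed.

Lemma pderivN i f : tfun f -> pderiv i (fun x => - f x) = (fun x => - pderiv i f x).
Proof.
by move=> tf; apply/funext => x; apply: deriveN; exact: tfun_derivable.
Qed.

Lemma torus_int_sum (I : Type) (s : seq I) (P : pred I) (f : I -> 'rV[R]_n -> R) :
  (forall k, tfun (f k)) ->
  torus_int (fun x => \sum_(k <- s | P k) f k x) = \sum_(k <- s | P k) torus_int (f k).
Proof.
move=> tf; elim: s => [|k s IH].
  by under eq_fun do rewrite big_nil; rewrite big_nil torus_int_cst.
under eq_fun do rewrite big_cons; rewrite big_cons; case: (P k) => //.
by rewrite torus_intD ?IH//; apply: tfun_continuous => //; exact: tfun_sum.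
Qed.

Lemma torus_int_pderiv_eq0 j f : tfun f -> torus_int (pderiv j f) = 0.
Proof.
move=> tf; apply: torus_int_pderiv.
- exact: tfun_continuous.
- by case: tf.
- by move=> x; exact: tfun_derivable.
- by apply: tfun_continuous; exact: tfun_pderiv.
Qed.

Lemma torus_int_by_parts j f g : tfun f -> tfun g ->
  torus_int (fun x => f x * pderiv j g x) = - torus_int (fun x => pderiv j f x * g x).
Proof.
move=> tf tg; apply/eqP; rewrite -addr_eq0 addrC -torus_intD.
- by rewrite -pderivM// torus_int_pderiv_eq0//; exact: tfunM.
- by apply: tfun_continuous; apply: tfunM => //; exact: tfun_pderiv.
- by apply: tfun_continuous; apply: tfunM => //; exact: tfun_pderiv.
Qed.

(* Integrating by parts against difference quotients avoids the symmetry of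
   second partial derivatives. *)
Lemma torus_int_pderiv_swap i j f g : tfun f -> tfun g ->
  torus_int (fun x => pderiv i f x * pderiv j g x) =
  torus_int (fun x => pderiv i g x * pderiv j f x).
Proof.
move=> tf tg.
have tfi := tfun_pderiv i tf; have tgi := tfun_pderiv i tg.
have cdf := tfun_continuous (tfun_pderiv j tf).
have cdg := tfun_continuous (tfun_pderiv j tg).
have cI k (h : R) (F : 'rV[R]_n -> R) : tfun F -> tfun k ->
    continuous (fun x => k x * diffq j F h x).
  move=> tF tk; apply: continuous_mul; first exact: tfun_continuous.
  by apply: diffq_continuous1; apply: tfun_continuous; exact: tfun_pderiv.
rewrite -(diffq0 j f) -(diffq0 j g) -{2}oppr0.
(* By translation invariance, moving a forward difference quotient from [g] to [f] yields minus a
   backward one, whence the step [- h]; the minus sign cancels against that of the integration by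
   parts in [i]. *)
apply: (@continuous_ext0 _ (fun h => torus_int (fun x => pderiv i f x * diffq j g h x))
  (fun h => torus_int (fun x => pderiv i g x * diffq j f (- h) x))).
- exact: (torus_int_mul_diffq cdg (tfun_continuous tfi)).
- apply: (continuous_compose (f := fun h : R => - h)
    (g := fun h => torus_int (fun x => pderiv i g x * diffq j f h x))).
    by apply: continuous_opp; exact: continuous_id.
  exact: (torus_int_mul_diffq cdf (tfun_continuous tgi)).
move=> h h0; apply: (mulfI h0); 
have E1 : h * torus_int (fun x => pderiv i f x * diffq j g h x) =
    torus_int (fun x => pderiv i f x * (g (x + h *: evec R j) - g x)).
  rewrite -(torus_intZ h (cI _ h _ tg tfi)); congr torus_int.
  by apply/funext => x; rewrite mulrCA diffqE// => y; exact: tfun_derivable.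
have E2 : h * torus_int (fun x => pderiv i g x * diffq j f (- h) x) =
    torus_int (fun x => (f x - f (x + - h *: evec R j)) * pderiv i g x).
  rewrite -(torus_intZ h (cI _ (- h) _ tf tgi)); congr torus_int.
  apply/funext => x; rewrite -opprB -(@diffqE _ _ j f)//; first by ring.
  by move=> y; exact: tfun_derivable.
have tgh := tfun_shift h j tg.
rewrite [LHS]E1 [RHS]E2.
have tD : tfun (fun x => g (x + h *: evec R j) - g x).
  exact: (tfunD tgh (tfunN tg)).
have := torus_int_by_parts i tf tD.
rewrite -[RHS]opprK => /(congr1 -%R); rewrite !opprK => <-.
rewrite (pderivD _ tgh (tfunN tg)) (pderivN i tg).
rewrite [pderiv i _](pderiv_shift i j h g).
have c1 : continuous (fun x => f x * pderiv i g x).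
  exact: (tfun_continuous (tfunM tf tgi)).
have c2 : continuous (fun x => f x * pderiv i g (x + h *: evec R j)).
  exact: (tfun_continuous (tfunM tf (tfun_shift h j tgi))).
have c3 : continuous (fun x => f (x + - h *: evec R j) * pderiv i g x).
  exact: (tfun_continuous (tfunM (tfun_shift (- h) j tf) tgi)).
under eq_fun do rewrite mulrBr; under [in RHS]eq_fun do rewrite mulrBl.
rewrite (torus_intB c2 c1) (torus_intB c1 c3) opprB; congr (_ - _).
have [_ p3] := tfunM (tfun_shift (- h) j tf) tgi.
rewrite -(torus_int_shift h j c3 p3).
congr torus_int; apply/funext => x /=.
by rewrite scaleNr addrK.
Qed.

Lemma pderiv0_cst f : tfun f -> (forall i x, pderiv i f x = 0) -> forall x, f x = f 0.
Proof.
move=> tf df x; rewrite [x]row_sum_delta.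
elim: (index_enum _) => [|j s IH]; first by rewrite big_nil.
rewrite big_cons -IH addrC; set y := \sum_(k <- s) _.
rewrite -[in RHS](addr0 y) -(scale0r (evec R j)).
apply: (@is_derive_0_is_cst _ (fun t => f (y + t *: evec R j))) => t.
by rewrite -(df j (y + t *: evec R j)); apply: is_derive_line; exact: tfun_derivable.
Qed.

End SmoothPeriodic.

(** * Definiteness of the metric and uniqueness of the covariant derivative *)

Section Metric.
Context {R : realType} {n : nat}.
Implicit Types (u v w z : vf R n) (x : 'rV[R]_n) (i j : 'I_n).

Lemma vcomp_tfun u j : is_vf u -> tfun (vcomp u j).
Proof. by move=> /(_ j). Qed.

Lemma vcomp_linear (r : R) u v j :
  vcomp (fun x => r *: u x + v x) j = (fun x => r * vcomp u j x + vcomp v j x).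
Proof. by apply/funext => x; rewrite /vcomp !mxE. Qed.

Lemma tfun_linear (r : R) (f g : 'rV[R]_n -> R) : tfun f -> tfun g ->
  tfun (fun x => r * f x + g x).
Proof. by move=> tf tg; apply: tfunD tg; apply: tfunM tf; exact: tfun_cst. Qed.

Lemma pderiv_linear i (r : R) (f g : 'rV[R]_n -> R) : tfun f -> tfun g ->
  pderiv i (fun x => r * f x + g x) = (fun x => r * pderiv i f x + pderiv i g x).
Proof.
move=> tf tg; have tr := @tfun_cst R n r.
rewrite (pderivD i (tfunM tr tf) tg) (pderivM i tr tf) pderiv_cst.
by apply/funext => x; rewrite mul0r add0r.
Qed.

Lemma is_vf_linear (r : R) u v : is_vf u -> is_vf v ->
  is_vf (fun x => r *: u x + v x).
Proof.
move=> hu hv j; rewrite vcomp_linear.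
exact: (tfun_linear r (vcomp_tfun j hu) (vcomp_tfun j hv)).
Qed.

Lemma in_liealg_linear (a r : R) u v : in_liealg a u -> in_liealg a v ->
  in_liealg a (fun x => r *: u x + v x).
Proof.
move=> [hu u0] [hv v0]; split; first exact: is_vf_linear.
by move=> a0; rewrite (u0 a0) (v0 a0) scaler0 addr0.
Qed.

Lemma codiff_tfun u : is_vf u -> tfun (codiff u).
Proof.
move=> hu; apply: tfunN; apply: tfun_sum => j.
exact: (tfun_pderiv j (vcomp_tfun j hu)).
Qed.

Lemma dflat_tfun u i j : is_vf u -> tfun (dflat u i j).
Proof.
move=> hu; apply: tfunD (tfun_pderiv i (vcomp_tfun j hu)) _.
exact: (tfunN (tfun_pderiv j (vcomp_tfun i hu))).
Qed.

Lemma dotf_tfun u v : is_vf u -> is_vf v -> tfun (dotf u v).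
Proof.
move=> hu hv; apply: tfun_sum => j.
exact: (tfunM (vcomp_tfun j hu) (vcomp_tfun j hv)).
Qed.

Lemma dot2_tfun u v : is_vf u -> is_vf v -> tfun (dot2 u v).
Proof.
move=> hu hv; apply: tfun_sum => i; apply: tfun_sum => j.
exact: (tfunM (dflat_tfun i j hu) (dflat_tfun i j hv)).
Qed.

Lemma codiff_linear (r : R) u v x : is_vf u -> is_vf v ->
  codiff (fun x => r *: u x + v x) x = r * codiff u x + codiff v x.
Proof.
move=> hu hv; rewrite /codiff mulrN -opprD mulr_sumr -big_split /=; congr (- _).
apply: eq_bigr => i _; rewrite vcomp_linear.
by rewrite (pderiv_linear i r (vcomp_tfun i hu) (vcomp_tfun i hv)).
Qed.

Lemma dflat_linear (r : R) u v i j x : is_vf u -> is_vf v ->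
  dflat (fun x => r *: u x + v x) i j x = r * dflat u i j x + dflat v i j x.
Proof.
move=> hu hv; rewrite /dflat !vcomp_linear.
rewrite (pderiv_linear i r (vcomp_tfun j hu) (vcomp_tfun j hv)).
rewrite (pderiv_linear j r (vcomp_tfun i hu) (vcomp_tfun i hv)).
by ring.
Qed.

Lemma abc_metricC (a b c : R) u v : abc_metric a b c u v = abc_metric a b c v u.
Proof.
rewrite /abc_metric; congr (_ * _ + _ * _ + _ * _); congr torus_int.
- by apply/funext => x; apply: eq_bigr => j _; rewrite mulrC.
- by apply/funext => x; rewrite mulrC.
- by apply/funext => x; apply: eq_bigr => i _; apply: eq_bigr => j _; rewrite mulrC.
Qed.

Lemma abc_metric_linear (a b c r : R) u v z : is_vf u -> is_vf v -> is_vf z ->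
  abc_metric a b c (fun x => r *: u x + v x) z =
  r * abc_metric a b c u z + abc_metric a b c v z.
Proof.
move=> hu hv hz; rewrite /abc_metric.
have E1 : dotf (fun x => r *: u x + v x) z = (fun x => r * dotf u z x + dotf v z x).
  apply/funext => x; rewrite /dotf mulr_sumr -big_split /=.
  by apply: eq_bigr => j _; rewrite !mxE; ring.
have E2 : (fun x => codiff (fun x => r *: u x + v x) x * codiff z x) =
    (fun x => r * (codiff u x * codiff z x) + codiff v x * codiff z x).
  by apply/funext => x; rewrite (codiff_linear r x hu hv); ring.
have E3 : dot2 (fun x => r *: u x + v x) z = (fun x => r * dot2 u z x + dot2 v z x).
  apply/funext => x; rewrite /dot2 mulr_sumr -big_split /=.
  apply: eq_bigr => i _; rewrite mulr_sumr -big_split /=; apply: eq_bigr => j _.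
  by rewrite (dflat_linear r i j x hu hv); ring.
rewrite E1 E2 E3.
rewrite (torus_int_linear r (tfun_continuous (dotf_tfun hu hz))
  (tfun_continuous (dotf_tfun hv hz))).
rewrite (torus_int_linear r
  (tfun_continuous (tfunM (codiff_tfun hu) (codiff_tfun hz)))
  (tfun_continuous (tfunM (codiff_tfun hv) (codiff_tfun hz)))).
rewrite (torus_int_linear r (tfun_continuous (dot2_tfun hu hz))
  (tfun_continuous (dot2_tfun hv hz))).
by ring.
Qed.

Lemma abc_metricB (a b c : R) u v z : is_vf u -> is_vf v -> is_vf z ->
  abc_metric a b c (fun x => u x - v x) z =
  abc_metric a b c u z - abc_metric a b c v z.
Proof.
move=> hu hv hz.
have -> : (fun x => u x - v x) = (fun x => -1 *: v x + u x).
  by apply/funext => x; rewrite scaleN1r addrC.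
by rewrite (abc_metric_linear a b c (-1) hv hu hz); ring.
Qed.

Lemma torus_int_sqr_eq0 (f : 'rV[R]_n -> R) : tfun f ->
  torus_int (fun x => f x * f x) = 0 -> forall x, f x = 0.
Proof.
move=> tf If x; have tff := tfunM tf tf.
have := torus_int_eq0 (tfun_continuous tff) tff.2 _ If x.
by move=> /(_ (fun x => sqr_ge0 (f x)))/eqP; rewrite mulf_eq0 orbb => /eqP.
Qed.

Lemma dotf_ge0 u x : 0 <= dotf u u x.
Proof. by apply: sumr_ge0 => j _; exact: sqr_ge0. Qed.

Lemma dot2_ge0 u x : 0 <= dot2 u u x.
Proof. by apply: sumr_ge0 => i _; apply: sumr_ge0 => j _; exact: sqr_ge0. Qed.

(* By [torus_int_pderiv_swap], the integral of |grad u|^2 is that of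
   (div u)^2 when the gradient of [u] is symmetric. *)
Lemma harmonic_cst u : is_vf u -> (forall x, codiff u x = 0) ->
  (forall i j x, dflat u i j x = 0) -> forall x, u x = u 0.
Proof.
move=> hu cu du x.
have sym i j : pderiv i (vcomp u j) = pderiv j (vcomp u i).
  by apply/funext => y; apply/eqP; rewrite -subr_eq0; apply/eqP/du.
have td i j : tfun (pderiv i (vcomp u j)) := tfun_pderiv i (vcomp_tfun j hu).
pose E i j := torus_int (fun x => pderiv i (vcomp u j) x * pderiv i (vcomp u j) x).
have E0 i j : 0 <= E i j by apply: torus_int_ge0 => y; exact: sqr_ge0.
have sE : \sum_i \sum_j E i j = 0.
  transitivity (torus_int (fun x => codiff u x * codiff u x)); last first.
    by rewrite -[RHS](@torus_int_cst R n 0); congr torus_int; apply/funext => y;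
       rewrite cu mul0r.
  transitivity (\sum_i \sum_j
      torus_int (fun x => pderiv i (vcomp u i) x * pderiv j (vcomp u j) x)).
    apply: eq_bigr => i _; apply: eq_bigr => j _; rewrite /E {2}sym.
    exact: (torus_int_pderiv_swap i j (vcomp_tfun j hu) (vcomp_tfun i hu)).
  transitivity (torus_int (fun x => \sum_i \sum_j
      pderiv i (vcomp u i) x * pderiv j (vcomp u j) x)).
    rewrite torus_int_sum; last first.
      by move=> i; apply: tfun_sum => j; exact: (tfunM (td i i) (td j j)).
    by apply: eq_bigr => i _; rewrite torus_int_sum// => j;
       exact: (tfunM (td i i) (td j j)).
  congr torus_int; apply/funext => y; rewrite /codiff mulrNN mulr_suml.
  by apply: eq_bigr => i _; rewrite mulr_sumr.
have Eij i j : E i j = 0.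
  apply: (psumr_eq0P (P := predT) (F := E i)) => //.
  apply: (psumr_eq0P (P := predT) (F := fun i => \sum_j E i j)) => // k _.
  exact: sumr_ge0.
apply/rowP => j; apply: (@pderiv0_cst _ _ (vcomp u j)); first exact: (hu j).
by move=> i y; apply: torus_int_sqr_eq0 (td i j) (Eij i j) y.
Qed.

Definition admissible (a b c : R) := [/\ 0 <= a, 0 <= b, 0 <= c &
  [|| (a != 0) && (b != 0), (a != 0) && (c != 0) | (b != 0) && (c != 0)]].

Lemma abc_metric_eq0 (a b c : R) u : admissible a b c -> in_liealg a u ->
  abc_metric a b c u u = 0 -> u = (fun _ => 0).
Proof.
case=> a0 b0 c0 abc [hu u0].
have I1 := torus_int_ge0 (dotf_ge0 u).
have I2 : 0 <= torus_int (fun x => codiff u x * codiff u x).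
  by apply: torus_int_ge0 => x; exact: sqr_ge0.
have I3 := torus_int_ge0 (dot2_ge0 u).
rewrite /abc_metric => /eqP; rewrite !paddr_eq0 ?addr_ge0 ?mulr_ge0//.
rewrite !mulf_eq0 => /andP[/andP[J1 J2] J3]; apply/funext => x.
have [az|an] := eqVneq a 0; last first.
  move: J1; rewrite (negbTE an) /= => /eqP J1.
  have tu := dotf_tfun hu hu.
  have ux := torus_int_eq0 (tfun_continuous tu) tu.2 (dotf_ge0 u) J1 x.
  apply/rowP => j; rewrite mxE; apply/eqP; rewrite -(orbb (_ == 0)) -mulf_eq0.
  apply/eqP.
  apply: (psumr_eq0P (P := predT) (F := fun j => u x 0 j * u x 0 j) _ ux) => //.
  by move=> k _; exact: sqr_ge0.
move: abc; rewrite az eqxx /= => /andP[bn cn].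
move: J2 J3; rewrite (negbTE bn) (negbTE cn) /= => /eqP J2 /eqP J3.
(* Harmonic fields are only constant; the normalisation at the origin makes the constant zero. *)
rewrite -(u0 az); apply: (harmonic_cst hu).
  exact: (torus_int_sqr_eq0 (codiff_tfun hu) J2).
have tu := dot2_tfun hu hu.
have D y := torus_int_eq0 (tfun_continuous tu) tu.2 (dot2_ge0 u) J3 y.
(* [dot2] records only the entries above the diagonal; antisymmetry of [dflat] supplies the
   others. *)
have lt i j y : (i < j)%N -> dflat u i j y = 0.
  move=> ij; apply/eqP; rewrite -(orbb (_ == 0)) -mulf_eq0; apply/eqP.
  have S : \sum_(k < n | (i < k)%N) dflat u i k y * dflat u i k y = 0.
    apply: (psumr_eq0P (P := predT)
      (F := fun i : 'I_n => \sum_(k < n | (i < k)%N) dflat u i k y * dflat u i k y)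
      _ (D y)) => // l _.
    by apply: sumr_ge0 => k _; exact: sqr_ge0.
  apply: (psumr_eq0P (P := fun k : 'I_n => (i < k)%N)
    (F := fun k => dflat u i k y * dflat u i k y) _ S) => //.
  by move=> k _; exact: sqr_ge0.
move=> i j y; case: (ltngtP i j) => [/lt//|ji|/val_inj ->].
  by rewrite /dflat -opprB; apply/eqP; rewrite oppr_eq0; apply/eqP/lt.
by rewrite /dflat subrr.
Qed.

Definition represents_koszul (a b c : R) u v w :=
  in_liealg a w /\
  forall z, in_liealg a z -> abc_metric a b c w z = koszul a b c u v z.

(** The witness [w] activates the specification of [epsilon]. Two representatives differ by a field
    of the Lie algebra orthogonal to all of it, in particular to itself, and definiteness
    applies. *)
Lemma nabla_unique (a b c : R) u v w : admissible a b c ->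
  represents_koszul a b c u v w -> nabla a b c u v = w.
Proof.
move=> abc [lw Kw].
have [lN KN] : represents_koszul a b c u v (nabla a b c u v).
  apply: (epsilon_spec (inhabits (fun _ => 0)) (represents_koszul a b c u v)).
  by exists w; split.
have ld : in_liealg a (fun x => -1 *: w x + nabla a b c u v x).
  exact: in_liealg_linear.
have d0 : (fun x => -1 *: w x + nabla a b c u v x) = (fun _ => 0).
  apply: (abc_metric_eq0 abc ld).
  rewrite (abc_metric_linear a b c _ lw.1 lN.1 ld.1).
  by rewrite Kw// KN// mulN1r addNr.
apply/funext => x; apply/eqP; rewrite -subr_eq0 addrC -scaleN1r.
by apply/eqP; exact: (congr1 (fun f => f x) d0).
Qed.

Lemma nabla_represents (a b c : R) u v w z : admissible a b c ->
  represents_koszul a b c u v w -> in_liealg a z ->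
  is_vf (nabla a b c u v) /\
  abc_metric a b c (nabla a b c u v) z = koszul a b c u v z.
Proof.
move=> abc Kw lz; rewrite (nabla_unique abc Kw).
by case: Kw => -[hw _] Kw; split=> //; exact: Kw.
Qed.

(** Pairing with [u] turns each outer covariant derivative into a Koszul form, so [w3], [w4] and
    [w5] only have to exist and do not occur in the value. *)
Lemma sec_num_koszul (a b c : R) u v w1 w2 w3 w4 w5 : admissible a b c ->
  in_liealg a u ->
  represents_koszul a b c v v w1 -> represents_koszul a b c u v w2 ->
  represents_koszul a b c u w1 w3 -> represents_koszul a b c v w2 w4 ->
  represents_koszul a b c (liebr u v) v w5 ->
  sec_num a b c u v = koszul a b c u w1 u - koszul a b c v w2 u
                      - koszul a b c (liebr u v) v u.
Proof.
move=> abc lu K1 K2 K3 K4 K5; rewrite /sec_num /curv.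
rewrite (nabla_unique abc K1) (nabla_unique abc K2).
have [h3 <-] := nabla_represents abc K3 lu.
have [h4 <-] := nabla_represents abc K4 lu.
have [h5 <-] := nabla_represents abc K5 lu.
rewrite -(abc_metricB a b c h3 h4 lu.1) -abc_metricB//; last by case: lu.
rewrite (_ : (fun x => _ - _) =
  (fun x => -1 *: nabla a b c v w2 x + nabla a b c u w1 x)).
  exact: is_vf_linear.
by apply/funext => x; rewrite scaleN1r addrC.
Qed.

End Metric.

(** * Fields depending on one coordinate *)

(* Naming the values at [x] spares [ring] the conversion tests between them. *)
Ltac ring_at x :=
  cbv beta; repeat match goal with |- context [?h x] => generalize (h x); intro end; ring.

Section PlaneFields.
Context {R : realType} {n : nat} (i0 i1 : 'I_n).
Hypothesis lt01 : (i0 < i1)%N.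
Implicit Types (f g p q F G : 'rV[R]_n -> R) (x : 'rV[R]_n) (z : vf R n).

Let neq01 : i1 != i0.
Proof. by apply/eqP => e; move: lt01; rewrite e ltnn. Qed.

Let neq10 : i0 != i1. Proof. by rewrite eq_sym. Qed.

Local Notation D := (pderiv i0).

(** Dependence on one coordinate is encoded as invariance under shifts in the other directions, a
    form that [pderiv_shift] transports to derivatives. *)
Definition xfun f := tfun f /\
  forall (h : R) i, i != i0 -> f \o (fun x => x + h *: evec R i) = f.

Lemma xfun_tfun f : xfun f -> tfun f. Proof. by case. Qed.

Lemma xfun_pderiv f i : xfun f -> i != i0 -> pderiv i f = (fun _ => 0).
Proof.
move=> [_ hf] /hf H; apply/funext => x; rewrite /pderiv /derive.
rewrite (_ : (fun h : R => _) = (fun _ => 0)); first exact: lim_cst.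
apply/funext => h /=; have /(congr1 (fun F => F x)) /= := H h.
by rewrite addrC => ->; rewrite subrr scaler0.
Qed.

Lemma xfun_D f : xfun f -> xfun (D f).
Proof.
case=> tf hf; split; first exact: tfun_pderiv.
by move=> h i ii; rewrite -pderiv_shift (hf h i ii).
Qed.

Lemma xfun_cst (r : R) : xfun (fun _ => r).
Proof. by split; first exact: tfun_cst. Qed.

Lemma xfunD f g : xfun f -> xfun g -> xfun (fun x => f x + g x).
Proof.
move=> [tf hf] [tg hg]; split; first exact: (tfunD tf tg).
move=> h i ii; rewrite -[in RHS](hf h i ii) -[in RHS](hg h i ii).
by apply/funext.
Qed.

Lemma xfunM f g : xfun f -> xfun g -> xfun (fun x => f x * g x).
Proof.
move=> [tf hf] [tg hg]; split; first exact: (tfunM tf tg).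
move=> h i ii; rewrite -[in RHS](hf h i ii) -[in RHS](hg h i ii).
by apply/funext.
Qed.

Lemma xfunN f : xfun f -> xfun (fun x => - f x).
Proof.
move=> [tf hf]; split; first exact: (tfunN tf).
by move=> h i ii; rewrite -[in RHS](hf h i ii); apply/funext.
Qed.

(** Bundling a function with its derivative lets closed forms of derivatives be assembled along the
    shape of the expression, side conditions included. *)
Definition xderiv f f' := [/\ xfun f, xfun f' & D f = f'].

Lemma xderiv_D f : xfun f -> xderiv f (D f).
Proof. by move=> xf; split=> //; exact: xfun_D. Qed.

Lemma xderiv_cst (r : R) : xderiv (fun _ => r) (fun _ => 0).
Proof. by split; [exact: xfun_cst|exact: xfun_cst|exact: pderiv_cst]. Qed.

Lemma xderivD f f' g g' : xderiv f f' -> xderiv g g' ->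
  xderiv (fun x => f x + g x) (fun x => f' x + g' x).
Proof.
move=> [xf xf' <-] [xg xg' <-]; split; [exact: (xfunD xf xg)| |].
  exact: (xfunD (xfun_D xf) (xfun_D xg)).
exact: (pderivD i0 xf.1 xg.1).
Qed.

Lemma xderivN f f' : xderiv f f' -> xderiv (fun x => - f x) (fun x => - f' x).
Proof.
move=> [xf xf' <-]; split; [exact: (xfunN xf)|exact: (xfunN (xfun_D xf))|].
exact: (pderivN i0 xf.1).
Qed.

Lemma xderivM f f' g g' : xderiv f f' -> xderiv g g' ->
  xderiv (fun x => f x * g x) (fun x => f' x * g x + f x * g' x).
Proof.
move=> [xf xf' <-] [xg xg' <-]; split; [exact: (xfunM xf xg)| |].
  exact: (xfunD (xfunM (xfun_D xf) xg) (xfunM xf (xfun_D xg))).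
exact: (pderivM i0 xf.1 xg.1).
Qed.

Lemma xderivZ (r : R) f f' : xderiv f f' ->
  xderiv (fun x => r * f x) (fun x => r * f' x).
Proof.
move=> xf; have := xderivM (xderiv_cst r) xf.
rewrite (_ : (fun x => 0 * f x + r * f' x) = (fun x => r * f' x))//.
by apply/funext => x; rewrite mul0r add0r.
Qed.

Lemma xderivE f f' : xderiv f f' -> D f = f'. Proof. by case. Qed.

(* The inertia operator of the metric: [ell a b] on first components and
   [ell a c] on second components of the fields [Lf f g] below. *)
Definition ell (a b : R) f : 'rV[R]_n -> R := fun x => a * f x - b * D (D f) x.

Lemma xfun_ell (a b : R) f : xfun f -> xfun (ell a b f).
Proof.
move=> xf; have xc r := xfun_cst r.
exact: (xfunD (xfunM (xc a) xf) (xfunN (xfunM (xc b) (xfun_D (xfun_D xf))))).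
Qed.

Lemma ellE (a b : R) f f1 f2 : xderiv f f1 -> xderiv f1 f2 ->
  ell a b f = (fun x => a * f x - b * f2 x).
Proof. by move=> [_ _ e1] [_ _ e2]; rewrite /ell e1 e2. Qed.

Lemma ell_val (a b : R) f x : ell a b f x = a * f x - b * D (D f) x.
Proof. by []. Qed.

Local Opaque pderiv ell torus_int.

Definition Lf f g : vf R n := fun x => f x *: evec R i0 + g x *: evec R i1.

Lemma LfE f g x j : Lf f g x 0 j = f x * (j == i0)%:R + g x * (j == i1)%:R.
Proof. by rewrite !mxE eqxx. Qed.

Lemma vcomp_Lf f g j :
  vcomp (Lf f g) j = if j == i0 then f else if j == i1 then g else (fun _ => 0).
Proof.
apply/funext => x; rewrite /vcomp LfE; have [->|_] := eqVneq j i0.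
  by rewrite (negbTE neq10) mulr1 mulr0 addr0.
by have [_|_] := eqVneq j i1; rewrite ?mulr1 !mulr0 ?addr0 ?add0r.
Qed.

Lemma vcomp_Lf0 f g : vcomp (Lf f g) i0 = f.
Proof. by rewrite vcomp_Lf eqxx. Qed.

Lemma vcomp_Lf1 f g : vcomp (Lf f g) i1 = g.
Proof. by rewrite vcomp_Lf eqxx (negbTE neq01). Qed.

Lemma xfun_vcomp_Lf f g j : xfun f -> xfun g -> xfun (vcomp (Lf f g) j).
Proof.
move=> xf xg; rewrite vcomp_Lf; case: ifP => _ //; case: ifP => _ //.
exact: xfun_cst.
Qed.

Lemma is_vf_Lf f g : xfun f -> xfun g -> is_vf (Lf f g).
Proof. by move=> xf xg j; case: (xfun_vcomp_Lf j xf xg). Qed.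

Lemma sum_Lf f g x (H : 'I_n -> R) :
  \sum_j Lf f g x 0 j * H j = f x * H i0 + g x * H i1.
Proof.
rewrite (bigD1 i0)//= (bigD1 i1)//= big1 ?addr0.
  by rewrite !LfE !eqxx (negbTE neq01) (negbTE neq10) !mulr1 !mulr0 addr0 add0r.
by move=> j /andP[j0 j1]; rewrite LfE (negbTE j0) (negbTE j1) !mulr0 addr0 mul0r.
Qed.

Lemma pderiv_vcomp_Lf f g i j : xfun f -> xfun g -> i != i0 ->
  pderiv i (vcomp (Lf f g) j) = (fun _ => 0).
Proof. by move=> xf xg; apply: xfun_pderiv; exact: xfun_vcomp_Lf. Qed.

Lemma codiff_Lf f g x : xfun f -> xfun g -> codiff (Lf f g) x = - D f x.
Proof.
move=> xf xg; rewrite /codiff (bigD1 i0)//= vcomp_Lf0 big1 ?addr0// => i ii.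
by rewrite pderiv_vcomp_Lf.
Qed.

Lemma dflat_Lf f g (i j : 'I_n) x : xfun f -> xfun g -> (i < j)%N ->
  dflat (Lf f g) i j x = if (i == i0) && (j == i1) then D g x else 0.
Proof.
move=> xf xg ij; rewrite /dflat.
have [ei|ni] := eqVneq i i0; last first.
  rewrite (pderiv_vcomp_Lf j xf xg ni) sub0r /=.
  have [ej|nj] := eqVneq j i0; last by rewrite (pderiv_vcomp_Lf i xf xg nj) oppr0.
  rewrite vcomp_Lf (negbTE ni) ej; case: eqP => [e|_].
    by move: ij; rewrite e ej ltnNge (ltnW lt01).
  by rewrite pderiv_cst oppr0.
have nj : j != i0 by apply/eqP => e; move: ij; rewrite e ei ltnn.
rewrite (pderiv_vcomp_Lf i xf xg nj) subr0 vcomp_Lf (negbTE nj) ei /=.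
by case: eqP => // _; rewrite pderiv_cst.
Qed.

(** The order [i0 < i1] places the only surviving entry of the curl among the pairs summed by
    [dot2]. *)
Lemma dot2_Lf f g z x : xfun f -> xfun g ->
  dot2 (Lf f g) z x = D g x * (D (vcomp z i1) x - pderiv i1 (vcomp z i0) x).
Proof.
move=> xf xg; rewrite /dot2 (bigD1 i0)//= [X in _ + X]big1 ?addr0; last first.
  move=> i ii; apply: big1 => j ij.
  by rewrite (dflat_Lf x xf xg ij) (negbTE ii) /= mul0r.
rewrite (bigD1 i1)//= big1 ?addr0; last first.
  move=> j /andP[ij j1].
  by rewrite (dflat_Lf x xf xg ij) (negbTE j1) andbF mul0r.
by rewrite (dflat_Lf x xf xg lt01) !eqxx.
Qed.

Lemma int_pderiv_D f (h : 'rV[R]_n -> R) : xfun f -> tfun h ->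
  torus_int (fun x => f x * D h x) = - torus_int (fun x => D f x * h x).
Proof. by case=> tf _ th; exact: torus_int_by_parts. Qed.

Lemma int_pderiv_neq f (h : 'rV[R]_n -> R) i : xfun f -> tfun h -> i != i0 ->
  torus_int (fun x => f x * pderiv i h x) = 0.
Proof.
move=> xf th ii; rewrite (torus_int_by_parts i xf.1 th) (xfun_pderiv xf ii).
rewrite (_ : (fun x => _) = (fun _ => 0)) ?torus_int_cst ?oppr0//.
by apply/funext => x; rewrite mul0r.
Qed.

(** All derivatives are moved off [z] by parts. Derivatives of [z] in directions other than [i0]
    integrate to zero against functions of [x_0], so an arbitrary [z] enters only through two
    components. *)
Lemma abc_metric_Lf (a b c : R) f g z : xfun f -> xfun g -> is_vf z ->
  abc_metric a b c (Lf f g) z =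
  torus_int (fun x => ell a b f x * vcomp z i0 x + ell a c g x * vcomp z i1 x).
Proof.
move=> xf xg hz.
have t0 := vcomp_tfun i0 hz; have t1 := vcomp_tfun i1 hz.
have tf := xf.1; have tg := xg.1.
have xDf := xfun_D xf; have xDg := xfun_D xg.
have cM (h k : 'rV[R]_n -> R) : tfun h -> tfun k -> continuous (fun x => h x * k x).
  by move=> th tk; exact: (tfun_continuous (tfunM th tk)).
rewrite /abc_metric.
have -> : torus_int (dotf (Lf f g) z) =
    torus_int (fun x => f x * vcomp z i0 x) + torus_int (fun x => g x * vcomp z i1 x).
  rewrite -(torus_intD (cM _ _ tf t0) (cM _ _ tg t1)).
  by congr torus_int; apply/funext => x; rewrite /dotf sum_Lf.
have -> : torus_int (fun x => codiff (Lf f g) x * codiff z x) =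
    - torus_int (fun x => D (D f) x * vcomp z i0 x).
  rewrite (_ : (fun x => codiff _ x * _) =
      (fun x => \sum_i D f x * pderiv i (vcomp z i) x)); last first.
    by apply/funext => x; rewrite codiff_Lf// /codiff mulrNN mulr_sumr.
  rewrite torus_int_sum; last first.
    by move=> i; exact: (tfunM xDf.1 (tfun_pderiv i (vcomp_tfun i hz))).
  rewrite (bigD1 i0)//= big1 ?addr0.
    exact: (int_pderiv_D xDf t0).
  by move=> i ii; exact: (int_pderiv_neq xDf (vcomp_tfun i hz) ii).
have -> : torus_int (dot2 (Lf f g) z) =
    - torus_int (fun x => D (D g) x * vcomp z i1 x).
  rewrite -(int_pderiv_D xDg t1) -[RHS]subr0 -(int_pderiv_neq xDg t0 neq01).
  rewrite -(torus_intB (cM _ _ xDg.1 (tfun_pderiv i0 t1))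
                       (cM _ _ xDg.1 (tfun_pderiv i1 t0))).
  by congr torus_int; apply/funext => x; rewrite dot2_Lf// mulrBr.
have c1 := cM _ _ tf t0; have c2 := cM _ _ tg t1.
have c3 := cM _ _ (xfun_D xDf).1 t0; have c4 := cM _ _ (xfun_D xDg).1 t1.
have cZ (r : R) (h : 'rV[R]_n -> R) : continuous h -> continuous (fun x => r * h x).
  by move=> ch; apply: continuous_mul ch; exact: cst_continuous.
rewrite (_ : (fun x => ell a b f x * _ + _) = (fun x =>
   a * (f x * vcomp z i0 x) + (a * (g x * vcomp z i1 x) +
   (- b * (D (D f) x * vcomp z i0 x) + - c * (D (D g) x * vcomp z i1 x)))));
  last by apply/funext => x; rewrite !ell_val; ring_at x.
rewrite (torus_int_linear a c1 (continuous_add (cZ a _ c2)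
   (continuous_add (cZ (- b) _ c3) (cZ (- c) _ c4)))).
rewrite (torus_int_linear a c2 (continuous_add (cZ (- b) _ c3) (cZ (- c) _ c4))).
rewrite (torus_int_linear (- b) c3 (cZ (- c) _ c4)) (torus_intZ (- c) c4).
by ring.
Qed.

Lemma vcomp_liebr_Lf F G z j x : xfun F -> xfun G ->
  vcomp (liebr (Lf F G) z) j x =
  - (F x * D (vcomp z j) x + G x * pderiv i1 (vcomp z j) x
     - vcomp z i0 x * D (vcomp (Lf F G) j) x).
Proof.
move=> xF xG; rewrite /vcomp /liebr /vfbracket !mxE sumrB; congr (- (_ - _)).
  exact: (sum_Lf F G x (fun i => pderiv i (vcomp z j) x)).
rewrite (bigD1 i0)//= big1 ?addr0// => i ii.
by rewrite [pderiv i _](pderiv_vcomp_Lf j xF xG ii) mulr0.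
Qed.

Lemma xfunB f g : xfun f -> xfun g -> xfun (fun x => f x - g x).
Proof. by move=> xf xg; exact: (xfunD xf (xfunN xg)). Qed.

(** One component of the bracket of fields with first components [f], [F], in a direction where
    their components are [g], [G]. The sign is that of [liebr], opposite to the vector field
    bracket. *)
Definition liecomp f g F G : 'rV[R]_n -> R := fun x => F x * D g x - f x * D G x.

Lemma xfun_liecomp f g F G : xfun f -> xfun g -> xfun F -> xfun G ->
  xfun (liecomp f g F G).
Proof.
move=> xf xg xF xG.
exact: (xfunB (xfunM xF (xfun_D xg)) (xfunM xf (xfun_D xG))).
Qed.

Lemma liebr_Lf f g F G : xfun f -> xfun g -> xfun F -> xfun G ->
  liebr (Lf f g) (Lf F G) = Lf (liecomp f f F F) (liecomp f g F G).
Proof.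
move=> xf xg xF xG; apply/funext => x; apply/rowP => j.
rewrite -[LHS]/(vcomp (liebr (Lf f g) (Lf F G)) j x) vcomp_liebr_Lf//.
rewrite -[RHS]/(vcomp (Lf _ _) j x).
rewrite [pderiv i1 _](pderiv_vcomp_Lf j xF xG neq01) mulr0 addr0 vcomp_Lf0.
rewrite !vcomp_Lf /liecomp; case: ifP => _; first by ring.
case: ifP => _; first by ring.
by rewrite !pderiv_cst; ring.
Qed.

Lemma liebrC (u v : vf R n) : liebr u v = (fun x => - liebr v u x).
Proof.
apply/funext => x; apply/rowP => j; rewrite !mxE; congr (- _).
by rewrite -sumrN; apply: eq_bigr => i _; rewrite opprB.
Qed.

Lemma is_vf_liebr (u v : vf R n) : is_vf u -> is_vf v -> is_vf (liebr u v).
Proof.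
move=> hu hv j.
have -> : vcomp (liebr u v) j = (fun x => - \sum_i
   (vcomp u i x * pderiv i (vcomp v j) x + - (vcomp v i x * pderiv i (vcomp u j) x))).
  by apply/funext => x; rewrite /vcomp /liebr /vfbracket !mxE.
apply: tfunN; apply: tfun_sum => i.
apply: (tfunD (tfunM (vcomp_tfun i hu) (tfun_pderiv i (vcomp_tfun j hv)))).
exact: (tfunN (tfunM (vcomp_tfun i hv) (tfun_pderiv i (vcomp_tfun j hu)))).
Qed.

(** This is the coadjoint action: integrating by parts leaves against [z] the Lie derivative along
    [Lf F G] of the momentum, the one-form density with components [ell a b f] and [ell a c g]. *)
Lemma abc_metric_liebr_Lf (a b c : R) f g F G z :
  xfun f -> xfun g -> xfun F -> xfun G -> is_vf z ->
  abc_metric a b c (liebr (Lf F G) z) (Lf f g) =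
  torus_int (fun x =>
    (D (fun y => F y * ell a b f y) x + ell a b f x * D F x + ell a c g x * D G x)
      * vcomp z i0 x
    + D (fun y => F y * ell a c g y) x * vcomp z i1 x).
Proof.
move=> xf xg xF xG hz.
have xAf := xfun_ell a b xf; have xBg := xfun_ell a c xg.
have t0 := vcomp_tfun i0 hz; have t1 := vcomp_tfun i1 hz.
have xP := xfunM xF xAf; have xQ := xfunM xF xBg.
have cM (h k : 'rV[R]_n -> R) : tfun h -> tfun k -> continuous (fun x => h x * k x).
  by move=> th tk; exact: (tfun_continuous (tfunM th tk)).
have xS := xfunD (xfunM xAf (xfun_D xF)) (xfunM xBg (xfun_D xG)).
rewrite abc_metricC (abc_metric_Lf a b c xf xg (is_vf_liebr (is_vf_Lf xF xG) hz)).
have xAG := xfunM xAf xG; have xBG := xfunM xBg xG.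
have c0 := cM _ _ xP.1 (tfun_pderiv i0 t0).
have c1 := cM _ _ xQ.1 (tfun_pderiv i0 t1).
have c2 := cM _ _ xAG.1 (tfun_pderiv i1 t0).
have c3 := cM _ _ xBG.1 (tfun_pderiv i1 t1).
have c4 := cM _ _ xS.1 t0.
have d0 := cM _ _ (xfun_D xP).1 t0.
have d1 := cM _ _ (xfun_D xQ).1 t1.
have cA (h k : 'rV[R]_n -> R) : continuous h -> continuous k ->
    continuous (fun x => h x + k x) by move=> ch ck; exact: (continuous_add ch ck).
have cN (h : 'rV[R]_n -> R) : continuous h -> continuous (fun x => -1 * h x).
  by move=> ch; apply: continuous_mul ch; exact: cst_continuous.
transitivity (torus_int (fun x =>
    -1 * ((F x * ell a b f x) * D (vcomp z i0) x) + (-1 * ((F x * ell a c g x) * D (vcomp z i1) x)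
    + (-1 * ((ell a b f x * G x) * pderiv i1 (vcomp z i0) x)
    + (-1 * ((ell a c g x * G x) * pderiv i1 (vcomp z i1) x)
    + (ell a b f x * D F x + ell a c g x * D G x) * vcomp z i0 x))))).
  congr torus_int; apply/funext => x; rewrite !vcomp_liebr_Lf// vcomp_Lf0 vcomp_Lf1.
  by ring_at x.
have c34 := cA _ _ (cN _ c3) c4; have c234 := cA _ _ (cN _ c2) c34.
rewrite (torus_int_linear (-1) c0 (cA _ _ (cN _ c1) c234)).
rewrite (torus_int_linear (-1) c1 c234) (torus_int_linear (-1) c2 c34).
rewrite (torus_int_linear (-1) c3 c4).
rewrite (int_pderiv_neq xAG t0 neq01) (int_pderiv_neq xBG t1 neq01).
rewrite (int_pderiv_D xP t0) (int_pderiv_D xQ t1).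
rewrite (_ : (fun x => (_ + _ + _) * _ + _) = (fun x =>
    (D (fun y => F y * ell a b f y) x * vcomp z i0 x
    + (ell a b f x * D F x + ell a c g x * D G x) * vcomp z i0 x)
    + D (fun y => F y * ell a c g y) x * vcomp z i1 x)); last first.
  by apply/funext => x; ring_at x.
rewrite (torus_intD (cA _ _ d0 c4) d1) (torus_intD d0 c4).
by rewrite !mulN1r !opprK !oppr0 !add0r addrA addrAC.
Qed.

(** First component of twice the momentum of the covariant derivative of [Lf F G] along [Lf f g]:
    the inertia operator on the bracket, minus the two coadjoint terms. [koszul1] is the second
    component. *)
Definition koszul0 (a b c : R) f g F G : 'rV[R]_n -> R := fun x =>
  ell a b (liecomp f f F F) x
  - (D (fun y => F y * ell a b f y) x + ell a b f x * D F x + ell a c g x * D G x)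
  - (D (fun y => f y * ell a b F y) x + ell a b F x * D f x + ell a c G x * D g x).

Definition koszul1 (a c : R) f g F G : 'rV[R]_n -> R := fun x =>
  ell a c (liecomp f g F G) x
  - D (fun y => F y * ell a c g y) x - D (fun y => f y * ell a c G y) x.

Lemma xfun_koszul0 (a b c : R) f g F G : xfun f -> xfun g -> xfun F -> xfun G ->
  xfun (koszul0 a b c f g F G).
Proof.
move=> xf xg xF xG; apply: xfunB; last first.
  exact: (xfunD (xfunD (xfun_D (xfunM xf (xfun_ell a b xF)))
    (xfunM (xfun_ell a b xF) (xfun_D xf))) (xfunM (xfun_ell a c xG) (xfun_D xg))).
apply: xfunB; last first.
  exact: (xfunD (xfunD (xfun_D (xfunM xF (xfun_ell a b xf)))
    (xfunM (xfun_ell a b xf) (xfun_D xF))) (xfunM (xfun_ell a c xg) (xfun_D xG))).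
exact: (xfun_ell a b (xfun_liecomp xf xf xF xF)).
Qed.

Lemma xfun_koszul1 (a c : R) f g F G : xfun f -> xfun g -> xfun F -> xfun G ->
  xfun (koszul1 a c f g F G).
Proof.
move=> xf xg xF xG.
apply: xfunB; last exact: (xfun_D (xfunM xf (xfun_ell a c xG))).
apply: xfunB; last exact: (xfun_D (xfunM xF (xfun_ell a c xg))).
exact: (xfun_ell a c (xfun_liecomp xf xg xF xG)).
Qed.

Lemma koszul_Lf (a b c : R) f g F G z :
  xfun f -> xfun g -> xfun F -> xfun G -> is_vf z ->
  koszul a b c (Lf f g) (Lf F G) z = torus_int (fun x =>
    koszul0 a b c f g F G x * vcomp z i0 x + koszul1 a c f g F G x * vcomp z i1 x) / 2.
Proof.
move=> xf xg xF xG hz; rewrite /koszul; congr (_ / 2).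
have t0 := vcomp_tfun i0 hz; have t1 := vcomp_tfun i1 hz.
have xl0 := xfun_liecomp xf xf xF xF.
have xl1 := xfun_liecomp xf xg xF xG.
have -> : abc_metric a b c (liebr z (Lf f g)) (Lf F G) =
    - abc_metric a b c (liebr (Lf f g) z) (Lf F G).
  have h1 := is_vf_liebr (is_vf_Lf xf xg) hz; have h2 := is_vf_Lf xF xG.
  (* Writing [- w] as [-2 w + w] gives it the shape [r *: u x + v x] of [abc_metric_linear]. *)
  rewrite liebrC (_ : (fun x => _) =
     (fun x => -2 *: liebr (Lf f g) z x + liebr (Lf f g) z x)); last first.
    by apply/funext => x; rewrite -{3}[liebr _ _ x]scale1r -scalerDl -scaleN1r;
       congr (_ *: _); ring.
  by rewrite (abc_metric_linear a b c (-2) h1 h1 h2); ring.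
rewrite (abc_metric_liebr_Lf a b c xf xg xF xG hz).
rewrite (abc_metric_liebr_Lf a b c xF xG xf xg hz).
rewrite (liebr_Lf xf xg xF xG) (abc_metric_Lf a b c xl0 xl1 hz).
have cM (h k : 'rV[R]_n -> R) : tfun h -> tfun k -> continuous (fun x => h x * k x).
  by move=> th tk; exact: (tfun_continuous (tfunM th tk)).
have T f' g' F' G' : xfun f' -> xfun g' -> xfun F' -> xfun G' -> continuous (fun x =>
    (D (fun y => F' y * ell a b f' y) x + ell a b f' x * D F' x + ell a c g' x * D G' x)
      * vcomp z i0 x + D (fun y => F' y * ell a c g' y) x * vcomp z i1 x).
  move=> xf' xg' xF' xG'.
  have xE := (xfunD (xfunD (xfun_D (xfunM xF' (xfun_ell a b xf')))
      (xfunM (xfun_ell a b xf') (xfun_D xF'))) (xfunM (xfun_ell a c xg') (xfun_D xG'))).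
  exact: (continuous_add (cM _ _ xE.1 t0)
    (cM _ _ (xfun_D (xfunM xF' (xfun_ell a c xg'))).1 t1)).
have c0 := continuous_add (cM _ _ (xfun_ell a b xl0).1 t0) (cM _ _ (xfun_ell a c xl1).1 t1).
have c1 := T _ _ _ _ xf xg xF xG; have c2 := T _ _ _ _ xF xG xf xg.
have cB (h k : 'rV[R]_n -> R) : continuous h -> continuous k ->
    continuous (fun x => h x - k x).
  by move=> ch ck; exact: (continuous_add ch (continuous_opp ck)).
rewrite -(torus_intB c0 c1) -(torus_intB (cB _ _ c0 c1) c2); congr torus_int.
by apply/funext => x; rewrite /koszul0 /koszul1; ring_at x.
Qed.

(** When the third field also depends on [x_0] only, its brackets are known outright; this form
    avoids the derivatives of [ell] that occur in [koszul0] and serves the final evaluations. *)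
Lemma koszul_Lf3 (a b c : R) f g F G p q :
  xfun f -> xfun g -> xfun F -> xfun G -> xfun p -> xfun q ->
  koszul a b c (Lf f g) (Lf F G) (Lf p q) = torus_int (fun x =>
    ell a b p x * liecomp f f F F x + ell a c q x * liecomp f g F G x
    - (ell a b f x * liecomp F F p p x + ell a c g x * liecomp F G p q x)
    + (ell a b F x * liecomp p p f f x + ell a c G x * liecomp p q f g x)) / 2.
Proof.
move=> xf xg xF xG xp xq; rewrite /koszul; congr (_ / 2).
have E f' g' F' G' p' q' : xfun f' -> xfun g' -> xfun F' -> xfun G' -> xfun p' ->
    xfun q' -> abc_metric a b c (liebr (Lf f' g') (Lf F' G')) (Lf p' q') =
    torus_int (fun x => ell a b p' x * liecomp f' f' F' F' x
      + ell a c q' x * liecomp f' g' F' G' x).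
  move=> x1 x2 x3 x4 x5 x6; rewrite abc_metricC (liebr_Lf x1 x2 x3 x4).
  have x7 := xfun_liecomp x1 x1 x3 x3.
  have x8 := xfun_liecomp x1 x2 x3 x4.
  by rewrite (abc_metric_Lf a b c x5 x6 (is_vf_Lf x7 x8)) vcomp_Lf0 vcomp_Lf1.
have C f' g' F' G' p' q' : xfun f' -> xfun g' -> xfun F' -> xfun G' -> xfun p' ->
    xfun q' -> continuous (fun x => ell a b p' x * liecomp f' f' F' F' x
      + ell a c q' x * liecomp f' g' F' G' x).
  move=> x1 x2 x3 x4 x5 x6; apply: tfun_continuous; apply: (xfun_tfun).
  exact: (xfunD (xfunM (xfun_ell a b x5) (xfun_liecomp x1 x1 x3 x3))
    (xfunM (xfun_ell a c x6) (xfun_liecomp x1 x2 x3 x4))).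
rewrite (E _ _ _ _ _ _ xf xg xF xG xp xq) (E _ _ _ _ _ _ xF xG xp xq xf xg).
rewrite (E _ _ _ _ _ _ xp xq xf xg xF xG).
have c1 := C _ _ _ _ _ _ xf xg xF xG xp xq; have c2 := C _ _ _ _ _ _ xF xG xp xq xf xg.
have c3 := C _ _ _ _ _ _ xp xq xf xg xF xG.
rewrite -(torus_intB c1 c2) -(torus_intD (continuous_add c1 (continuous_opp c2)) c3).
by congr torus_int; apply/funext => x; ring.
Qed.

(** For [a = 0] this moves a solution into the Lie algebra of fields vanishing at the origin, at no
    cost since [ell 0 b] annihilates constants; for [a != 0] it is the identity. *)
Definition norm0 (a : R) f : 'rV[R]_n -> R := fun x => f x - (a == 0)%:R * f 0.

Lemma xfun_norm0 (a : R) f : xfun f -> xfun (norm0 a f).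
Proof. by move=> xf; exact: (xfunB xf (xfun_cst _)). Qed.

Lemma D_norm0 (a : R) f : xfun f -> D (norm0 a f) = D f.
Proof.
move=> xf; have [_ _ ->] := xderivD (xderiv_D xf) (xderivN (xderiv_cst ((a == 0)%:R * f 0))).
by apply/funext => x; rewrite oppr0 addr0.
Qed.

Lemma ell_norm0 (a b : R) f : xfun f -> ell a b (norm0 a f) = ell a b f.
Proof.
move=> xf; apply/funext => x; rewrite !ell_val (D_norm0 a xf) /norm0.
by have [->|_] := eqVneq a 0; rewrite ?mul0r ?subr0.
Qed.

Lemma in_liealg_Lf (a : R) f g : xfun f -> xfun g -> (a = 0 -> f 0 = 0 /\ g 0 = 0) ->
  in_liealg a (Lf f g).
Proof.
move=> xf xg fg0; split; first exact: is_vf_Lf.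
by move=> /fg0[f0 g0]; rewrite /Lf f0 g0 !scale0r addr0.
Qed.

(** Comparing densities against [z] reduces the covariant derivative to two linear differential
    equations in [x_0], one per component; [norm0] does not disturb them. *)
Lemma represents_koszul_Lf (a b c : R) f g F G p q :
  xfun f -> xfun g -> xfun F -> xfun G -> xfun p -> xfun q ->
  (forall x, ell a b p x = koszul0 a b c f g F G x / 2) ->
  (forall x, ell a c q x = koszul1 a c f g F G x / 2) ->
  represents_koszul a b c (Lf f g) (Lf F G) (Lf (norm0 a p) (norm0 a q)).
Proof.
move=> xf xg xF xG xp xq Ep Eq.
have xp' := xfun_norm0 a xp; have xq' := xfun_norm0 a xq; split.
  apply: in_liealg_Lf => // ->.
  by rewrite /norm0 eqxx !mul1r !subrr.
move=> z [hz _]; rewrite (koszul_Lf a b c xf xg xF xG hz).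
rewrite (abc_metric_Lf a b c xp' xq' hz) (ell_norm0 a b xp) (ell_norm0 a c xq).
have t0 := vcomp_tfun i0 hz; have t1 := vcomp_tfun i1 hz.
rewrite mulrC -torus_intZ; last first.
  exact: (tfun_continuous (tfunD (tfunM (xfun_koszul0 a b c xf xg xF xG).1 t0)
    (tfunM (xfun_koszul1 a c xf xg xF xG).1 t1))).
by congr torus_int; apply/funext => x; rewrite Ep Eq;
   generalize (koszul0 a b c f g F G x) (koszul1 a c f g F G x); intros; field.
Qed.

(* For [a = 0] the Koszul densities are exact, hence in the range of [ell]. *)
Lemma torus_int_koszul0 (b c : R) f g F G : xfun f -> xfun g -> xfun F -> xfun G ->
  torus_int (koszul0 0 b c f g F G) = 0.
Proof.
move=> xf xg xF xG.
have d k := @xderiv_D k.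
have xl := xfun_liecomp xf xf xF xF.
have e1 : xderiv (fun y => F y * ell 0 b f y) (D (fun y => F y * ell 0 b f y)).
  exact: (d _ (xfunM xF (xfun_ell 0 b xf))).
have e2 : xderiv (fun y => f y * ell 0 b F y) (D (fun y => f y * ell 0 b F y)).
  exact: (d _ (xfunM xf (xfun_ell 0 b xF))).
have e3 := d _ (xfun_D xl).
(* The products without an outer derivative combine: [ell 0 b f * D F + ell 0 b F * D f] is [- b]
   times the derivative of [D f * D F], and likewise for [g], [G] with [c]. *)
have e4 := xderivM (d _ (xfun_D xf)) (d _ (xfun_D xF)).
have e5 := xderivM (d _ (xfun_D xg)) (d _ (xfun_D xG)).
have [X _ E] := xderivD (xderivD (xderivN (xderivZ b e3)) (xderivN (xderivD e1 e2)))
  (xderivD (xderivZ b e4) (xderivZ c e5)).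
rewrite -[RHS](torus_int_pderiv_eq0 i0 X.1) E; congr torus_int; apply/funext => x.
by rewrite /koszul0 !ell_val; ring_at x.
Qed.

Lemma torus_int_koszul1 (c : R) f g F G : xfun f -> xfun g -> xfun F -> xfun G ->
  torus_int (koszul1 0 c f g F G) = 0.
Proof.
move=> xf xg xF xG.
have d k := @xderiv_D k.
have xl := xfun_liecomp xf xg xF xG.
have e1 : xderiv (fun y => F y * ell 0 c g y) (D (fun y => F y * ell 0 c g y)).
  exact: (d _ (xfunM xF (xfun_ell 0 c xg))).
have e2 : xderiv (fun y => f y * ell 0 c G y) (D (fun y => f y * ell 0 c G y)).
  exact: (d _ (xfunM xf (xfun_ell 0 c xG))).
have e3 := d _ (xfun_D xl).
have [X _ E] := xderivD (xderivN (xderivZ c e3)) (xderivN (xderivD e1 e2)).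
rewrite -[RHS](torus_int_pderiv_eq0 i0 X.1) E; congr torus_int; apply/funext => x.
by rewrite /koszul1 !ell_val; ring_at x.
Qed.

End PlaneFields.

(** * Trigonometric polynomials *)

Definition twopi (R : realType) : R := pi *+ 2.

Lemma twopi_gt0 (R : realType) : 0 < twopi R.
Proof. by rewrite mulrn_wgt0// pi_gt0. Qed.

(* The eigenvalue of [ell a b] on trigonometric functions of frequency [k]. *)
Definition symbol {R : realType} (a b : R) (k : nat) : R :=
  a + b * (k%:R * twopi R) ^+ 2.

Section Trigonometric.
Context {R : realType} {n : nat} (i0 i1 : 'I_n).
Implicit Types (f g F G p q : 'rV[R]_n -> R) (x : 'rV[R]_n) (k l : nat).

Local Notation D := (pderiv i0).
Local Notation om := (twopi R).

Definition cosk k : 'rV[R]_n -> R := fun x => cos (k%:R * om * x 0 i0).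
Definition sink k : 'rV[R]_n -> R := fun x => sin (k%:R * om * x 0 i0).

Lemma is_derive_coord (phi : R -> R) (phi' : R) x i :
  is_derive (x 0 i0) 1 phi phi' ->
  is_derive x (evec R i) (fun x => phi (x 0 i0)) ((i == i0)%:R * phi').
Proof.
move=> [dphi ephi].
have [ii|ii] := eqVneq i i0; last first.
  rewrite mul0r.
  have E : (fun h : R => h^-1 *: (((fun x => phi (x 0 i0)) \o +%R^~ x) (h *: evec R i)
      - phi (x 0 i0))) = (fun _ => 0).
    apply/funext => h /=.
    by rewrite !mxE eqxx /= eq_sym (negbTE ii) mulr0 add0r subrr scaler0.
  apply: DeriveDef; rewrite /derivable /derive E; last exact: lim_cst.
  exact: is_cvg_cst.
have E : (fun h : R => h^-1 *: (((fun x => phi (x 0 i0)) \o +%R^~ x) (h *: evec R i)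
    - phi (x 0 i0))) =
    (fun h : R => h^-1 *: ((phi \o +%R^~ (x 0 i0)) (h *: (1 : R)) - phi (x 0 i0))).
  by apply/funext => h /=; rewrite !mxE eqxx /= ii eqxx.
by rewrite mul1r; apply: DeriveDef; rewrite /derivable /derive E.
Qed.

Lemma is_derive_scale (phi : R -> R) (r t phi' : R) : is_derive (r * t) 1 phi phi' ->
  is_derive t 1 (fun t => phi (r * t)) (r * phi').
Proof.
move=> dphi; rewrite mulrC.
apply: (@is_derive1_comp _ phi (fun t => r * t)).
have := @is_deriveM R R (cst r) id t 1 0 1 (is_derive_cst _ _ _) (is_derive_id _ _).
by rewrite scaler0 addr0 [_ *: _]mulr1.
Qed.

Lemma is_derive_cosk k x i :
  is_derive x (evec R i) (cosk k) ((i == i0)%:R * (k%:R * om * - sink k x)).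
Proof.
apply: (is_derive_coord (phi := fun t => cos (k%:R * om * t))).
by apply: is_derive_scale; exact: is_derive_cos.
Qed.

Lemma is_derive_sink k x i :
  is_derive x (evec R i) (sink k) ((i == i0)%:R * (k%:R * om * cosk k x)).
Proof.
apply: (is_derive_coord (phi := fun t => sin (k%:R * om * t))).
by apply: is_derive_scale; exact: is_derive_sin.
Qed.

Lemma trig_periodic k (phi : R -> R) : (forall t, phi (t + om) = phi t) ->
  forall t, phi (t + k%:R * om) = phi t.
Proof.
move=> p; elim: k => [|k IH] t; first by rewrite mul0r addr0.
by rewrite -natr1 mulrDl mul1r addrA p.
Qed.

Lemma xfun_coord (phi : R -> R) : tfun (fun x : 'rV[R]_n => phi (x 0 i0)) ->
  xfun i0 (fun x : 'rV[R]_n => phi (x 0 i0)).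
Proof.
move=> tp; split=> // h i ii; apply/funext => x /=.
by rewrite !mxE eqxx /= eq_sym (negbTE ii) mulr0 addr0.
Qed.

(** The span of the sine and cosine of one frequency is stable under all partial derivatives;
    directions other than [i0] lead to the zero combination. *)
Lemma smooth_trig (r s : R) k : smooth_fun (fun x => r * cosk k x + s * sink k x).
Proof.
apply: (@smooth_fun_coind _ _ (fun f => exists r s : R,
  f = fun x => r * cosk k x + s * sink k x)); last by exists r, s.
move=> _ [{}r [{}s ->]].
have c0 : continuous (fun x : 'rV[R]_n => k%:R * om * x 0 i0).
  apply: continuous_mul; first exact: cst_continuous.
  exact: coord_continuous.
have cc : continuous (cosk k).
  by apply: continuous_compose c0 _ => t; exact: continuous_cos.
have cs : continuous (sink k).
  by apply: continuous_compose c0 _ => t; exact: continuous_sin.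
have d i x : is_derive x (evec R i) (fun x => r * cosk k x + s * sink k x)
    (r * ((i == i0)%:R * (k%:R * om * - sink k x)) +
     s * ((i == i0)%:R * (k%:R * om * cosk k x))).
  apply: is_deriveD.
    have := @is_deriveM R _ (cst r) (cosk k) x _ 0 _
      (is_derive_cst _ _ _) (is_derive_cosk k x i).
    by rewrite scaler0 addr0.
  have := @is_deriveM R _ (cst s) (sink k) x _ 0 _
    (is_derive_cst _ _ _) (is_derive_sink k x i).
  by rewrite scaler0 addr0.
split.
  apply: continuous_add; apply: continuous_mul => //; exact: cst_continuous.
move=> i; split; first by move=> x; have [] := d i x.
exists (s * (i == i0)%:R * (k%:R * om)), (- r * (i == i0)%:R * (k%:R * om)).
apply/funext => x; rewrite [LHS](@derive_val _ _ _ _ _ _ _ (d i x)).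
by ring.
Qed.

Lemma tfun_trig (r s : R) k : tfun (fun x => r * cosk k x + s * sink k x).
Proof.
split; first exact: smooth_trig.
move=> x i; rewrite /cosk /sink !mxE eqxx /=; have [_|_] := eqVneq i0 i; last first.
  by rewrite addr0.
by rewrite mulrDr mulr1 (trig_periodic _ (@cosD2pi R)) (trig_periodic _ (@sinD2pi R)).
Qed.

Lemma xfun_cosk k : xfun i0 (cosk k).
Proof.
apply: (xfun_coord (phi := fun t => cos (k%:R * om * t))).
have := tfun_trig 1 0 k; congr tfun; apply/funext => x.
by rewrite mul1r mul0r addr0.
Qed.

Lemma xfun_sink k : xfun i0 (sink k).
Proof.
apply: (xfun_coord (phi := fun t => sin (k%:R * om * t))).
have := tfun_trig 0 1 k; congr tfun; apply/funext => x.
by rewrite mul1r mul0r add0r.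
Qed.

Lemma xderiv_cosk k : xderiv i0 (cosk k) (fun x => - (k%:R * om) * sink k x).
Proof.
have xs := xfunM (xfun_cst i0 (- (k%:R * om))) (xfun_sink k).
split; [exact: xfun_cosk|exact: xs|apply/funext => x].
rewrite [LHS](@derive_val _ _ _ _ _ _ _ (is_derive_cosk k x i0)) eqxx.
by rewrite mul1r mulrN mulNr.
Qed.

Lemma xderiv_sink k : xderiv i0 (sink k) (fun x => (k%:R * om) * cosk k x).
Proof.
have xc := xfunM (xfun_cst i0 (k%:R * om)) (xfun_cosk k).
split; [exact: xfun_sink|exact: xc|apply/funext => x].
by rewrite [LHS](@derive_val _ _ _ _ _ _ _ (is_derive_sink k x i0)) eqxx mul1r.
Qed.

Lemma cosk0 x : cosk 0 x = 1. Proof. by rewrite /cosk !mul0r cos0. Qed.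

Lemma sink0 x : sink 0 x = 0. Proof. by rewrite /sink !mul0r sin0. Qed.

Lemma cosk_at0 k : cosk k 0 = 1. Proof. by rewrite /cosk mxE mulr0 cos0. Qed.

Lemma sink_at0 k : sink k 0 = 0. Proof. by rewrite /sink mxE mulr0 sin0. Qed.

Let angleD k l x :
  (k + l)%:R * om * x 0 i0 = k%:R * om * x 0 i0 + l%:R * om * x 0 i0.
Proof. by rewrite natrD !mulrDl. Qed.

Let angleB k l x : (l <= k)%N ->
  (k - l)%:R * om * x 0 i0 = k%:R * om * x 0 i0 - l%:R * om * x 0 i0.
Proof. by move=> lk; rewrite natrB// !mulrBl. Qed.

(** Frequencies are natural numbers, so [l <= k] keeps [k - l] an honest difference here and in the
    next three formulas. *)
Lemma cosk_cosk k l x : (l <= k)%N ->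
  cosk k x * cosk l x = (cosk (k + l) x + cosk (k - l) x) / 2.
Proof. by move=> lk; rewrite /cosk (angleD k l) (angleB x lk) cosB cosD; field. Qed.

Lemma sink_sink k l x : (l <= k)%N ->
  sink k x * sink l x = (cosk (k - l) x - cosk (k + l) x) / 2.
Proof. by move=> lk; rewrite /cosk /sink (angleD k l) (angleB x lk) cosB cosD; field. Qed.

Lemma sink_cosk k l x : (l <= k)%N ->
  sink k x * cosk l x = (sink (k + l) x + sink (k - l) x) / 2.
Proof. by move=> lk; rewrite /cosk /sink (angleD k l) (angleB x lk) sinB sinD; field. Qed.

Lemma cosk_sink k l x : (l <= k)%N ->
  cosk k x * sink l x = (sink (k + l) x - sink (k - l) x) / 2.
Proof. by move=> lk; rewrite /cosk /sink (angleD k l) (angleB x lk) sinB sinD; field. Qed.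

Lemma torus_int_cosk k : (0 < k)%N -> torus_int (cosk k) = 0.
Proof.
move=> k0.
have w0 : k%:R * om != 0.
  by rewrite gt_eqF// mulr_gt0 ?ltr0n// twopi_gt0.
have [_ _ e] := xderivZ (k%:R * om)^-1 (xderiv_sink k).
rewrite -[RHS](torus_int_pderiv_eq0 i0 (xfunM (xfun_cst i0 (k%:R * om)^-1) (xfun_sink k)).1).
by rewrite e; congr torus_int; apply/funext => x; rewrite mulrA mulVf// mul1r.
Qed.

(** A linear span rather than an algebra: [ell] is diagonal on the generators, so inverting it is an
    induction. Closure under products then comes from the product-to-sum formulas. *)
Inductive trigpoly : ('rV[R]_n -> R) -> Prop :=
| trig_cosk k : trigpoly (cosk k)
| trig_sink k : trigpoly (sink k)
| trigD f g : trigpoly f -> trigpoly g -> trigpoly (fun x => f x + g x)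
| trigZ (r : R) f : trigpoly f -> trigpoly (fun x => r * f x).

Lemma trig_xfun f : trigpoly f -> xfun i0 f.
Proof.
elim=> [k|k|h k _ xh _ xk|r h _ xh]; [exact: xfun_cosk|exact: xfun_sink| |].
  exact: (xfunD xh xk).
exact: (xfunM (xfun_cst _ r) xh).
Qed.

Lemma trig_eq f g : (forall x, f x = g x) -> trigpoly f -> trigpoly g.
Proof. by move=> /funext ->. Qed.

Lemma trig_cst (r : R) : trigpoly (fun _ => r).
Proof.
by apply: trig_eq (trigZ r (trig_cosk 0)) => x; rewrite cosk0 mulr1.
Qed.

Lemma trigN f : trigpoly f -> trigpoly (fun x => - f x).
Proof. by move=> tf; apply: trig_eq (trigZ (-1) tf) => x; rewrite mulN1r. Qed.

Lemma trigB f g : trigpoly f -> trigpoly g -> trigpoly (fun x => f x - g x).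
Proof. by move=> tf tg; exact: (trigD tf (trigN tg)). Qed.

Lemma trig_cosk_mul k f : trigpoly f -> trigpoly (fun x => cosk k x * f x).
Proof.
elim=> [l|l|f1 f2 _ t1 _ t2|r f1 _ t1].
- case: (leqP l k) => lk.
    apply: trig_eq (trigZ 2^-1 (trigD (trig_cosk (k + l)) (trig_cosk (k - l)))) => x.
    by rewrite cosk_cosk// mulrC.
  apply: trig_eq (trigZ 2^-1 (trigD (trig_cosk (l + k)) (trig_cosk (l - k)))) => x.
  by rewrite [RHS]mulrC cosk_cosk 1?ltnW// mulrC.
- case: (leqP l k) => lk.
    apply: trig_eq (trigZ 2^-1 (trigB (trig_sink (k + l)) (trig_sink (k - l)))) => x.
    by rewrite cosk_sink// mulrC.
  apply: trig_eq (trigZ 2^-1 (trigD (trig_sink (l + k)) (trig_sink (l - k)))) => x.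
  by rewrite [RHS]mulrC sink_cosk 1?ltnW// mulrC.
- by apply: trig_eq (trigD t1 t2) => x; rewrite mulrDr.
- by apply: trig_eq (trigZ r t1) => x; rewrite mulrCA.
Qed.

Lemma trig_sink_mul k f : trigpoly f -> trigpoly (fun x => sink k x * f x).
Proof.
elim=> [l|l|f1 f2 _ t1 _ t2|r f1 _ t1].
- by apply: trig_eq (trig_cosk_mul l (trig_sink k)) => x; rewrite mulrC.
- case: (leqP l k) => lk.
    apply: trig_eq (trigZ 2^-1 (trigB (trig_cosk (k - l)) (trig_cosk (k + l)))) => x.
    by rewrite sink_sink// mulrC.
  apply: trig_eq (trigZ 2^-1 (trigB (trig_cosk (l - k)) (trig_cosk (l + k)))) => x.
  by rewrite [RHS]mulrC sink_sink 1?ltnW// mulrC.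
- by apply: trig_eq (trigD t1 t2) => x; rewrite mulrDr.
- by apply: trig_eq (trigZ r t1) => x; rewrite mulrCA.
Qed.

Lemma trigM f g : trigpoly f -> trigpoly g -> trigpoly (fun x => f x * g x).
Proof.
move=> tf tg; elim: tf => [k|k|f1 f2 _ t1 _ t2|r f1 _ t1].
- exact: trig_cosk_mul.
- exact: trig_sink_mul.
- by apply: trig_eq (trigD t1 t2) => x; rewrite mulrDl.
- by apply: trig_eq (trigZ r t1) => x; rewrite mulrA.
Qed.

Lemma trig_D f : trigpoly f -> trigpoly (D f).
Proof.
elim=> [k|k|f1 f2 t1 d1 t2 d2|r f1 t1 d1].
- by rewrite (xderivE (xderiv_cosk k)); exact: (trigZ _ (trig_sink k)).
- by rewrite (xderivE (xderiv_sink k)); exact: (trigZ _ (trig_cosk k)).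
- rewrite (pderivD i0 (trig_xfun t1).1 (trig_xfun t2).1); exact: (trigD d1 d2).
- rewrite (xderivE (xderivZ r (xderiv_D (trig_xfun t1)))); exact: (trigZ r d1).
Qed.

Lemma trig_ell (a b : R) f : trigpoly f -> trigpoly (ell i0 a b f).
Proof. by move=> tf; exact: (trigB (trigZ a tf) (trigZ b (trig_D (trig_D tf)))). Qed.

Lemma trig_liecomp f g F G : trigpoly f -> trigpoly g -> trigpoly F -> trigpoly G ->
  trigpoly (liecomp i0 f g F G).
Proof.
by move=> tf tg tF tG; exact: (trigB (trigM tF (trig_D tg)) (trigM tf (trig_D tG))).
Qed.

Lemma trig_koszul0 (a b c : R) f g F G :
  trigpoly f -> trigpoly g -> trigpoly F -> trigpoly G ->
  trigpoly (koszul0 i0 a b c f g F G).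
Proof.
move=> tf tg tF tG; apply: trigB; last first.
  exact: (trigD (trigD (trig_D (trigM tf (trig_ell a b tF)))
    (trigM (trig_ell a b tF) (trig_D tf))) (trigM (trig_ell a c tG) (trig_D tg))).
apply: trigB; last first.
  exact: (trigD (trigD (trig_D (trigM tF (trig_ell a b tf)))
    (trigM (trig_ell a b tf) (trig_D tF))) (trigM (trig_ell a c tg) (trig_D tG))).
exact: (trig_ell a b (trig_liecomp tf tf tF tF)).
Qed.

Lemma trig_koszul1 (a c : R) f g F G :
  trigpoly f -> trigpoly g -> trigpoly F -> trigpoly G ->
  trigpoly (koszul1 i0 a c f g F G).
Proof.
move=> tf tg tF tG; apply: trigB; last exact: (trig_D (trigM tf (trig_ell a c tG))).
apply: trigB; last exact: (trig_D (trigM tF (trig_ell a c tg))).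
exact: (trig_ell a c (trig_liecomp tf tg tF tG)).
Qed.

Lemma ell_cosk (a b : R) k x :
  ell i0 a b (cosk k) x = symbol a b k * cosk k x.
Proof.
rewrite (ellE a b (xderiv_cosk k) (xderivZ _ (xderiv_sink k))).
by rewrite /symbol; generalize (cosk k x); intros; ring.
Qed.

Lemma ell_sink (a b : R) k x :
  ell i0 a b (sink k) x = symbol a b k * sink k x.
Proof.
rewrite (ellE a b (xderiv_sink k) (xderivZ _ (xderiv_cosk k))).
by rewrite /symbol; generalize (sink k x); intros; ring.
Qed.

Lemma ellD (a b : R) f g x : xfun i0 f -> xfun i0 g ->
  ell i0 a b (fun x => f x + g x) x = ell i0 a b f x + ell i0 a b g x.
Proof.
move=> xf xg; have d := xderiv_D.
rewrite (ellE a b (xderivD (d _ _ _ _ xf) (d _ _ _ _ xg))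
  (xderivD (d _ _ _ _ (xfun_D xf)) (d _ _ _ _ (xfun_D xg)))) !ell_val.
by ring_at x.
Qed.

Lemma ellZ (a b r : R) f x : xfun i0 f ->
  ell i0 a b (fun x => r * f x) x = r * ell i0 a b f x.
Proof.
move=> xf; have d := xderiv_D.
rewrite (ellE a b (xderivZ r (d _ _ _ _ xf))
  (xderivZ r (d _ _ _ _ (xfun_D xf)))) !ell_val.
by ring_at x.
Qed.

Lemma ell_cst (a b r : R) x : ell i0 a b (fun _ => r) x = a * r.
Proof.
rewrite (ellE a b (xderiv_cst i0 r) (xderiv_cst i0 0)).
by rewrite mulr0 subr0.
Qed.

Lemma symbol_neq0 (a b : R) k : 0 <= a -> 0 <= b -> (a != 0) || (b != 0) ->
  (0 < k)%N -> symbol a b k != 0.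
Proof.
move=> a0 b0 ab k0; rewrite /symbol.
have w0 : 0 < (k%:R * om) ^+ 2.
  by rewrite exprn_gt0// mulr_gt0 ?ltr0n// twopi_gt0.
case/orP: ab => [an|bn]; rewrite gt_eqF//.
  by rewrite ltr_pwDl ?lt0r ?an// mulr_ge0// ltW.
by rewrite ltr_wpDl// mulr_gt0// lt0r bn.
Qed.

(** Every positive frequency has a nonzero symbol and is divided out; the frequency [0], where the
    symbol is [a] and may vanish, is collected in [m]. *)
Lemma ell_surj (a b : R) f : 0 <= a -> 0 <= b -> (a != 0) || (b != 0) -> trigpoly f ->
  exists m : R, exists2 p, trigpoly p & forall x, f x = m + ell i0 a b p x.
Proof.
move=> a0 b0 ab; elim=> [k|k|f1 f2 t1 [m1 [p1 q1 e1]] t2 [m2 [p2 q2 e2]]|r f1 t1 [m1 [p1 q1 e1]]].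
- have [->|k0] := posnP k.
    exists 1, (fun _ => 0); first exact: trig_cst.
    by move=> x; rewrite cosk0 ell_cst mulr0 addr0.
  exists 0, (fun x => (symbol a b k)^-1 * cosk k x).
    exact: (trigZ _ (trig_cosk k)).
  move=> x; rewrite (ellZ a b _ x (xfun_cosk k)) ell_cosk add0r mulrA mulVf ?mul1r//.
  exact: symbol_neq0.
- have [->|k0] := posnP k.
    exists 0, (fun _ => 0); first exact: trig_cst.
    by move=> x; rewrite sink0 ell_cst mulr0 addr0.
  exists 0, (fun x => (symbol a b k)^-1 * sink k x).
    exact: (trigZ _ (trig_sink k)).
  move=> x; rewrite (ellZ a b _ x (xfun_sink k)) ell_sink add0r mulrA mulVf ?mul1r//.
  exact: symbol_neq0.
- exists (m1 + m2), (fun x => p1 x + p2 x); first exact: (trigD q1 q2).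
  by move=> x; rewrite (ellD a b x (trig_xfun q1) (trig_xfun q2)) e1 e2 addrACA.
- exists (r * m1), (fun x => r * p1 x); first exact: (trigZ r q1).
  by move=> x; rewrite (ellZ a b r x (trig_xfun q1)) e1 mulrDr.
Qed.

(** For [a != 0] the leftover constant is absorbed by adding [m / a]. For [a = 0] it equals the mean
    of [f], because [ell 0 b p] is a derivative. *)
Lemma ell_solve (a b : R) f : 0 <= a -> 0 <= b -> (a != 0) || (b != 0) -> trigpoly f ->
  (a = 0 -> torus_int f = 0) -> exists2 p, trigpoly p & forall x, ell i0 a b p x = f x.
Proof.
move=> a0 b0 ab tf f0; have [m [p tp E]] := ell_surj a0 b0 ab tf.
have [az|an] := eqVneq a 0; last first.
  exists (fun x => p x + m / a); first exact: (trigD tp (trig_cst _)).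
  move=> x; rewrite (ellD a b x (trig_xfun tp) (xfun_cst _ _)) ell_cst E.
  by rewrite mulrC divfK// addrC.
exists p => // x; rewrite E; suff -> : m = 0 by rewrite add0r.
have xp := trig_xfun tp.
have := f0 az; have -> : f = (fun x => m + - b * D (D p) x).
  by apply/funext => y; rewrite E ell_val az mul0r sub0r mulNr.
rewrite torus_intD; [|exact: cst_continuous|]; last first.
  exact: (tfun_continuous (xfunM (xfun_cst i0 (- b)) (xfun_D (xfun_D xp))).1).
rewrite torus_int_cst (torus_intZ _ (tfun_continuous (xfun_D (xfun_D xp)).1)).
by rewrite (torus_int_pderiv_eq0 i0 (xfun_D xp).1) mulr0 addr0.
Qed.

Hypothesis lt01 : (i0 < i1)%N.

Lemma represents_koszul_trig (a b c : R) f g F G : admissible a b c ->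
  trigpoly f -> trigpoly g -> trigpoly F -> trigpoly G ->
  exists w, represents_koszul a b c (Lf i0 i1 f g) (Lf i0 i1 F G) w.
Proof.
case=> a0 b0 c0 abc tf tg tF tG.
have [xf xg xF xG] : [/\ xfun i0 f, xfun i0 g, xfun i0 F & xfun i0 G].
  by split; exact: trig_xfun.
have [ab ac] : (a != 0) || (b != 0) /\ (a != 0) || (c != 0).
  by move: abc; case: (a == 0); case: (b == 0); case: (c == 0).
have tK0 := trig_koszul0 a b c tf tg tF tG; have tK1 := trig_koszul1 a c tf tg tF tG.
have cK0 := tfun_continuous (trig_xfun tK0).1.
have cK1 := tfun_continuous (trig_xfun tK1).1.
have [|p tp Ep] := @ell_solve a b _ a0 b0 ab (trigZ 2^-1 tK0).
  by move=> az; rewrite (torus_intZ _ cK0) az (torus_int_koszul0 b c xf xg xF xG) mulr0.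
have [|q tq Eq] := @ell_solve a c _ a0 c0 ac (trigZ 2^-1 tK1).
  by move=> az; rewrite (torus_intZ _ cK1) az (torus_int_koszul1 c xf xg xF xG) mulr0.
exists (Lf i0 i1 (norm0 a p) (norm0 a q)).
apply: (represents_koszul_Lf lt01 xf xg xF xG (trig_xfun tp) (trig_xfun tq)).
  by move=> x; rewrite Ep mulrC.
by move=> x; rewrite Eq mulrC.
Qed.

End Trigonometric.

(** * Sectional curvature *)

Local Opaque pderiv ell torus_int.

Section Curvature.
Context {R : realType} {n : nat} (i0 i1 : 'I_n).
Hypothesis lt01 : (i0 < i1)%N.
Implicit Types (f g F G h p q r : 'rV[R]_n -> R) (x : 'rV[R]_n).

Local Notation D := (pderiv i0).
Local Notation om := (twopi R).
Local Notation L := (Lf i0 i1).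
Local Notation C := (@cosk R n i0).
Local Notation S := (@sink R n i0).
Local Notation O := (fun _ : 'rV[R]_n => 0 : R).
Local Notation ell := (ell i0).
Local Notation liecomp := (liecomp i0).

Let xO : xfun i0 O := xfun_cst i0 0.

Lemma ell_0 (a b : R) : ell a b O = O.
Proof. by apply/funext => x; rewrite ell_cst mulr0. Qed.

Lemma D_0 : D O = O. Proof. exact: pderiv_cst. Qed.

Lemma D_0mul f : D (fun x => O x * f x) = O.
Proof.
by rewrite (_ : (fun x => _) = O) ?D_0//; apply/funext => x; rewrite mul0r.
Qed.

Lemma D_mul0 f : D (fun x => f x * O x) = O.
Proof.
by rewrite (_ : (fun x => _) = O) ?D_0//; apply/funext => x; rewrite mulr0.
Qed.

Lemma norm0_0 (a : R) : norm0 a O = O.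
Proof. by apply/funext => x; rewrite /norm0 mulr0 subr0. Qed.

Lemma norm0_id (a : R) f : f 0 = 0 -> norm0 a f = f.
Proof. by move=> f0; apply/funext => x; rewrite /norm0 f0 mulr0 subr0. Qed.

Lemma liecomp0 f : liecomp f O O O = O.
Proof. by apply/funext => x; rewrite /liecomp D_0 mul0r mulr0 subrr. Qed.

Lemma liecomp0r f : liecomp f f O O = O.
Proof. by apply/funext => x; rewrite /liecomp D_0 mul0r mulr0 subrr. Qed.

Lemma liecomp0g g G : liecomp O g O G = O.
Proof. by apply/funext => x; rewrite /liecomp !mul0r subrr. Qed.

Lemma liecomp00 f F : liecomp f O F O = O.
Proof. by apply/funext => x; rewrite /liecomp D_0 !mulr0 subrr. Qed.

Lemma koszul0_vv (a b c : R) g x :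
  koszul0 i0 a b c O g O g x = - 2 * (ell a c g x * D g x).
Proof.
rewrite /koszul0 liecomp0 !ell_0 D_0 D_mul0 !mulr0.
by ring_at x.
Qed.

Lemma koszul1_vv (a c : R) g x : koszul1 i0 a c O g O g x = 0.
Proof. by rewrite /koszul1 liecomp0g D_0mul ell_0 !subr0. Qed.

Lemma koszul0_uv (a b c : R) f g x : koszul0 i0 a b c f O O g x = 0.
Proof.
transitivity (0 - (0 + 0 + 0) - (0 + 0 + 0) : R); last by rewrite !addr0 !subr0.
congr (_ - (_ + _ + _) - (_ + _ + _)).
- by rewrite liecomp0r ell_0.
- by rewrite D_0mul.
- by rewrite D_0 mulr0.
- by rewrite ell_0 mul0r.
- by rewrite ell_0 D_mul0.
- by rewrite ell_0 mul0r.
- by rewrite D_0 mulr0.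
Qed.

Lemma koszul1_uv (a c : R) f g x : koszul1 i0 a c f O O g x =
  ell a c (liecomp f O O g) x - D (fun y => f y * ell a c g y) x.
Proof. by rewrite /koszul1; congr (_ - _); rewrite D_0mul subr0. Qed.

Lemma koszul0_uu (a b c : R) f F x : koszul0 i0 a b c f O F O x =
  ell a b (liecomp f f F F) x
  - (D (fun y => F y * ell a b f y) x + ell a b f x * D F x)
  - (D (fun y => f y * ell a b F y) x + ell a b F x * D f x).
Proof. by rewrite /koszul0 !ell_0 D_0 !mul0r !addr0. Qed.

Lemma koszul1_uu (a c : R) f F x : koszul1 i0 a c f O F O x = 0.
Proof. by rewrite /koszul1 liecomp00 !ell_0 !D_mul0 !subr0. Qed.

Lemma koszul_uuu (a b c : R) f F p : xfun i0 f -> xfun i0 F -> xfun i0 p ->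
  koszul a b c (L f O) (L F O) (L p O) = torus_int (fun x =>
    ell a b p x * (F x * D f x - f x * D F x)
    - ell a b f x * (p x * D F x - F x * D p x)
    + ell a b F x * (f x * D p x - p x * D f x)) / 2.
Proof.
move=> xf xF xp; rewrite (koszul_Lf3 lt01 a b c xf xO xF xO xp xO).
congr (_ / 2); congr torus_int; apply/funext => x.
by rewrite !ell_0 /liecomp !mul0r !addr0.
Qed.

(** One of the three brackets is that of a field with itself, and the other two terms coincide,
    which cancels the factor [1 / 2]. *)
Lemma koszul_ufu (a b c : R) f h : xfun i0 f -> xfun i0 h ->
  koszul a b c (L f O) (L h O) (L f O) =
  torus_int (fun x => ell a b f x * (h x * D f x - f x * D h x)).
Proof.
move=> xf xh; rewrite (koszul_uuu a b c xf xh xf) mulrC -torus_intZ; last first.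
  have xT (k l m : 'rV[R]_n -> R) : xfun i0 k -> xfun i0 l -> xfun i0 m ->
      xfun i0 (fun x => ell a b k x * (l x * D m x - m x * D l x)).
    move=> xk xl xm; apply: (xfunM (xfun_ell a b xk)).
    exact: (xfunB (xfunM xl (xfun_D xm)) (xfunM xm (xfun_D xl))).
  exact: (tfun_continuous (xfunD (xfunB (xT _ _ _ xf xh xf) (xT _ _ _ xf xf xh))
    (xT _ _ _ xh xf xf)).1).
congr torus_int; apply/funext => x.
by generalize (ell a b f x) (ell a b h x) (f x) (h x) (D f x) (D h x); intros; field.
Qed.

Lemma koszul_vvu (a b c : R) f g r : xfun i0 f -> xfun i0 g -> xfun i0 r ->
  koszul a b c (L O g) (L O r) (L f O) = torus_int (fun x =>
    - (f x * (ell a c g x * D r x + ell a c r x * D g x))) / 2.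
Proof.
move=> xf xg xr; rewrite (koszul_Lf3 lt01 a b c xO xg xO xr xf xO).
congr (_ / 2); congr torus_int; apply/funext => x.
by rewrite !ell_0 /liecomp D_0 !mul0r; ring_at x.
Qed.

(** The listed frequencies cover all the final integrands. Their coefficients only have to exist:
    the mean is all that is kept. *)
Lemma torus_int_cospoly (m0 m1 m2 m3 m4 m6 : R) :
  torus_int (fun x => m0 + m1 * C 1 x + m2 * C 2 x + m3 * C 3 x + m4 * C 4 x
                      + m6 * C 6 x) = m0.
Proof.
have cC k : continuous (C k) by exact: (tfun_continuous (xfun_cosk i0 k).1).
have cZ (s : R) k : continuous (fun x => s * C k x).
  exact: (tfun_continuous (xfunM (xfun_cst i0 s) (xfun_cosk i0 k)).1).
have cA (u v : 'rV[R]_n -> R) : continuous u -> continuous v ->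
  continuous (fun x => u x + v x) by move=> cu cv; exact: (continuous_add cu cv).
have c1 : continuous (fun x => m0 + m1 * C 1 x).
  exact: (tfun_continuous (xfunD (xfun_cst i0 m0)
    (xfunM (xfun_cst i0 m1) (xfun_cosk i0 1))).1).
have c2 := cA _ _ c1 (cZ m2 2%N); have c3 := cA _ _ c2 (cZ m3 3%N).
have c4 := cA _ _ c3 (cZ m4 4%N).
have c0 : continuous (fun _ : 'rV[R]_n => m0) by exact: cst_continuous.
rewrite (torus_intD c4 (cZ m6 6%N)) (torus_intD c3 (cZ m4 4%N)).
rewrite (torus_intD c2 (cZ m3 3%N)) (torus_intD c1 (cZ m2 2%N)).
rewrite (torus_intD c0 (cZ m1 1%N)) torus_int_cst.
have I0 (s : R) k : (0 < k)%N -> torus_int (fun x => s * C k x) = 0.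
  by move=> k0; rewrite (torus_intZ s (cC k)) torus_int_cosk// mulr0.
by rewrite !I0// !addr0.
Qed.

Lemma xderiv_cc (s t : R) k l : xderiv i0 (fun x => s * C k x + t * C l x)
  (fun x => s * (- (k%:R * om) * S k x) + t * (- (l%:R * om) * S l x)).
Proof. exact: (xderivD (xderivZ s (xderiv_cosk i0 k)) (xderivZ t (xderiv_cosk i0 l))). Qed.

Lemma xderiv_ss (s t : R) k l : xderiv i0 (fun x => s * S k x + t * S l x)
  (fun x => s * (k%:R * om * C k x) + t * (l%:R * om * C l x)).
Proof. exact: (xderivD (xderivZ s (xderiv_sink i0 k)) (xderivZ t (xderiv_sink i0 l))). Qed.

Lemma trig_cc (s t : R) k l : trigpoly i0 (fun x => s * C k x + t * C l x).
Proof. exact: (trigD (trigZ s (trig_cosk i0 k)) (trigZ t (trig_cosk i0 l))). Qed.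

Lemma trig_ss (s t : R) k l : trigpoly i0 (fun x => s * S k x + t * S l x).
Proof. exact: (trigD (trigZ s (trig_sink i0 k)) (trigZ t (trig_sink i0 l))). Qed.

Lemma ell_cc (a b s t : R) k l x : ell a b (fun x => s * C k x + t * C l x) x =
  s * (symbol a b k * C k x) + t * (symbol a b l * C l x).
Proof.
have xk := @xfun_cosk R n i0 k; have xl := @xfun_cosk R n i0 l.
have xc := @xfun_cst R n i0.
rewrite (ellD a b x (xfunM (xc s) xk) (xfunM (xc t) xl)).
by rewrite (ellZ a b s x xk) (ellZ a b t x xl) !ell_cosk.
Qed.

Lemma ell_ss (a b s t : R) k l x : ell a b (fun x => s * S k x + t * S l x) x =
  s * (symbol a b k * S k x) + t * (symbol a b l * S l x).
Proof.
have xk := @xfun_sink R n i0 k; have xl := @xfun_sink R n i0 l.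
have xc := @xfun_cst R n i0.
rewrite (ellD a b x (xfunM (xc s) xk) (xfunM (xc t) xl)).
by rewrite (ellZ a b s x xk) (ellZ a b t x xl) !ell_sink.
Qed.

(** With [u = L f g] and [v = L F G], the pairs [p1], [q1] and [p2], [q2] give [nabla v v] and
    [nabla u v] up to normalisation; the outer representatives come from
    [represents_koszul_trig]. *)
Lemma sec_num_Lf (a b c : R) f g F G p1 q1 p2 q2 : admissible a b c ->
  trigpoly i0 f -> trigpoly i0 g -> trigpoly i0 F -> trigpoly i0 G ->
  trigpoly i0 p1 -> trigpoly i0 q1 -> trigpoly i0 p2 -> trigpoly i0 q2 ->
  (a = 0 -> f 0 = 0 /\ g 0 = 0) ->
  (forall x, ell a b p1 x = koszul0 i0 a b c F G F G x / 2) ->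
  (forall x, ell a c q1 x = koszul1 i0 a c F G F G x / 2) ->
  (forall x, ell a b p2 x = koszul0 i0 a b c f g F G x / 2) ->
  (forall x, ell a c q2 x = koszul1 i0 a c f g F G x / 2) ->
  sec_num a b c (L f g) (L F G) =
    koszul a b c (L f g) (L (norm0 a p1) (norm0 a q1)) (L f g)
    - koszul a b c (L F G) (L (norm0 a p2) (norm0 a q2)) (L f g)
    - koszul a b c (L (liecomp f f F F) (liecomp f g F G)) (L F G) (L f g).
Proof.
move=> abc tf tg tF tG tp1 tq1 tp2 tq2 fg0 E1 E2 E3 E4.
have X := @trig_xfun R n i0.
have tn p : trigpoly i0 p -> trigpoly i0 (norm0 a p).
  by move=> tp; exact: (trigB tp (trig_cst i0 _)).
have K1 := represents_koszul_Lf lt01 (X _ tF) (X _ tG) (X _ tF) (X _ tG) (X _ tp1) (X _ tq1) E1 E2.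
have K2 := represents_koszul_Lf lt01 (X _ tf) (X _ tg) (X _ tF) (X _ tG) (X _ tp2) (X _ tq2) E3 E4.
have [w3 K3] := represents_koszul_trig lt01 abc tf tg (tn _ tp1) (tn _ tq1).
have [w4 K4] := represents_koszul_trig lt01 abc tF tG (tn _ tp2) (tn _ tq2).
have [w5 K5] := represents_koszul_trig lt01 abc (trig_liecomp tf tf tF tF)
  (trig_liecomp tf tg tF tG) tF tG.
have lu := in_liealg_Lf lt01 (X _ tf) (X _ tg) fg0.
rewrite -(liebr_Lf lt01 (X _ tf) (X _ tg) (X _ tF) (X _ tG)) in K5 *.
exact: (sec_num_koszul abc lu K1 K2 K3 K4 K5).
Qed.

End Curvature.

(** * Reduction of the final integrands to single frequencies *)

Section TrigonometricIdentities.
Context {R : realType}.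
Variables (c1 c2 c3 c4 c6 s1 s2 s3 : R).
Hypotheses (C11 : c1 * c1 = (c2 + 1) / 2) (S11 : s1 * s1 = (1 - c2) / 2)
  (S21 : s2 * s1 = (c1 - c3) / 2) (C21 : c2 * c1 = (c3 + c1) / 2)
  (S22 : s2 * s2 = (1 - c4) / 2) (C22 : c2 * c2 = (c4 + 1) / 2)
  (S1C1 : s1 * c1 = s2 / 2) (C2S1 : c2 * s1 = (s3 - s1) / 2)
  (S31 : s3 * s1 = (c2 - c4) / 2) (S33 : s3 * s3 = (1 - c6) / 2)
  (C31 : c3 * c1 = (c4 + c2) / 2) (C33 : c3 * c3 = (c6 + 1) / 2).

Lemma mixed_ufu_identity (t e w a A2 H : R) :
  (t * a + e * (A2 * c2)) *
    (H * s2 * (e * (- (2 * w) * s2)) - (t + e * c2) * (H * (2 * w * c2))) =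
  - 2 * w * H * (a * t * e + e * t * A2 / 2) + 0 * c1
  + - 2 * w * H * (a * t * t + e * e * A2) * c2 + 0 * c3
  + - 2 * w * H * (e * t * A2 / 2) * c4 + 0 * c6.
Proof.
(* Multiples of the product-to-sum relations, each of which vanishes, are added so that both sides
   agree as rational expressions. The cofactors come from replacing the products one by one; the
   other identities follow the same scheme. *)
transitivity (- 2 * w * H * (a * t * e + e * t * A2 / 2) + 0 * c1
  + - 2 * w * H * (a * t * t + e * e * A2) * c2 + 0 * c3
  + - 2 * w * H * (e * t * A2 / 2) * c4 + 0 * c6
  + (- 2 * w * H * (t * a + e * (A2 * c2)) * e) * (s2 * s2 - (1 - c4) / 2)
  + (- 2 * w * H * (t * a + e * (A2 * c2)) * e + - 2 * w * H * e * A2 * t)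
     * (c2 * c2 - (c4 + 1) / 2)).
  by field.
by rewrite S22 C22 !subrr !mulr0 !addr0.
Qed.

Lemma mixed_vvu_identity (t e w B1 B3 r1 r3 : R) :
  - ((t + e * c2) * (B1 * s1 * (r1 * (- (1 * w) * s1) + r3 * (- (3 * w) * s3))
      + (r1 * (B1 * c1) + r3 * (B3 * c3)) * (1 * w * c1))) =
  w * e / 4 * (- 2 * B1 * r1 + (3 * B1 - B3) * r3) + 0 * c1
  + w / 2 * (B1 * ((t - e / 2) * (3 * r3) + e / 2 * r1 - (t - e / 2) * r1)
     - ((t + e / 2) * (r1 * B1) + (t + e / 2) * (r3 * B3) + e / 2 * (r1 * B1))) * c2
  + 0 * c3
  + w / 2 * (- B1 * ((t - e / 2) * (3 * r3) + e / 2 * r1)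
     - ((t + e / 2) * (r3 * B3) + e / 2 * (r1 * B1))) * c4
  + w / 2 * (- B1 * (e / 2) * (3 * r3) - e / 2 * (r3 * B3)) * c6.
Proof.
transitivity (
  w * e / 4 * (- 2 * B1 * r1 + (3 * B1 - B3) * r3) + 0 * c1
  + w / 2 * (B1 * ((t - e / 2) * (3 * r3) + e / 2 * r1 - (t - e / 2) * r1)
     - ((t + e / 2) * (r1 * B1) + (t + e / 2) * (r3 * B3) + e / 2 * (r1 * B1))) * c2
  + 0 * c3
  + w / 2 * (- B1 * ((t - e / 2) * (3 * r3) + e / 2 * r1)
     - ((t + e / 2) * (r3 * B3) + e / 2 * (r1 * B1))) * c4
  + w / 2 * (- B1 * (e / 2) * (3 * r3) - e / 2 * (r3 * B3)) * c6
  + (w * B1 * e * (r1 * s1 + 3 * r3 * s3)) * (c2 * s1 - (s3 - s1) / 2)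
  + (- w * e * (r1 * B1 * c1 + r3 * B3 * c3)) * (c2 * c1 - (c3 + c1) / 2)
  + (w * B1 * (t - e / 2) * r1) * (s1 * s1 - (1 - c2) / 2)
  + (w * B1 * ((t - e / 2) * (3 * r3) + e / 2 * r1)) * (s3 * s1 - (c2 - c4) / 2)
  + (w * B1 * (e / 2) * (3 * r3)) * (s3 * s3 - (1 - c6) / 2)
  + (- w * (t + e / 2) * (r1 * B1)) * (c1 * c1 - (c2 + 1) / 2)
  + (- w * ((t + e / 2) * (r3 * B3) + e / 2 * (r1 * B1))) * (c3 * c1 - (c4 + c2) / 2)
  + (- w * (e / 2) * (r3 * B3)) * (c3 * c3 - (c6 + 1) / 2)).
  by field.
by rewrite C2S1 C21 S11 S31 S33 C11 C31 C33 !subrr !mulr0 !addr0.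
Qed.

(** Integrand of the [nabla v v] term in [sec_circle]. The part in [T] cancels outright, being a
    bracket of [sin theta] with a multiple of itself. *)
Lemma circle_ufu_identity (w A T : R) :
  A * s1 * ((w * T * s1 + 3 / 8 * w * s2) * (1 * w * c1)
    - s1 * (w * T * (1 * w * c1) + 3 / 8 * w * (2 * w * c2))) =
  A * w * w * (9 / 32) + 0 * c1 + A * w * w * (- 3 / 8) * c2 + 0 * c3
  + A * w * w * (3 / 32) * c4 + 0 * c6.
Proof.
transitivity (
  A * w * w * (9 / 32) + 0 * c1 + A * w * w * (- 3 / 8) * c2 + 0 * c3
  + A * w * w * (3 / 32) * c4 + 0 * c6
  + (A * w * w * (3 / 8) * s2) * (s1 * c1 - s2 / 2)
  + (A * w * w * (3 / 16)) * (s2 * s2 - (1 - c4) / 2)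
  + (A * w * w * (- 3 / 4) * c2) * (s1 * s1 - (1 - c2) / 2)
  + (A * w * w * (3 / 8)) * (c2 * c2 - (c4 + 1) / 2)).
  by field.
by rewrite S1C1 S22 S11 C22 !subrr !mulr0 !addr0.
Qed.

Lemma circle_vwu_identity (w A P T : R) :
  A * s1 * ((P * c2 - P) * (- w * s1) - (c1 + T) * (P * (- (2 * w) * s2)))
  - A * c1 * (s1 * (P * (- (2 * w) * s2)) - (P * c2 - P) * (w * c1))
  + P * (4 * A * c2) * ((c1 + T) * (w * c1) - s1 * (- w * s1)) =
  A * w * P * (3 / 2) + A * w * P * (3 * T) * c1 + A * w * P * 3 * c2
  + A * w * P * T * c3 + A * w * P * (- 1 / 2) * c4 + 0 * c6.
Proof.
transitivity (
  A * w * P * (3 / 2) + A * w * P * (3 * T) * c1 + A * w * P * 3 * c2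
  + A * w * P * T * c3 + A * w * P * (- 1 / 2) * c4 + 0 * c6
  + (A * w * P * (5 * c2 - 1)) * (c1 * c1 - (c2 + 1) / 2)
  + (A * w * P * (3 * c2 + 1)) * (s1 * s1 - (1 - c2) / 2)
  + (A * w * P * (4 * s2)) * (s1 * c1 - s2 / 2)
  + (A * w * P * 2) * (s2 * s2 - (1 - c4) / 2)
  + (A * w * P * (2 * T)) * (s2 * s1 - (c1 - c3) / 2)
  + (A * w * P * (4 * T)) * (c2 * c1 - (c3 + c1) / 2)
  + (A * w * P) * (c2 * c2 - (c4 + 1) / 2)).
  by field.
by rewrite C11 S11 S1C1 S22 S21 C21 C22 !subrr !mulr0 !addr0.
Qed.

Lemma circle_lvu_identity (w A T : R) :
  A * s1 * ((c1 + T) * (w * T * (- w * s1)) - (w + w * T * c1) * (- w * s1))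
  - w * T * (A * c1) * (s1 * (- w * s1) - (c1 + T) * (w * c1))
  + A * c1 * ((w + w * T * c1) * (w * c1) - s1 * (w * T * (- w * s1))) =
  A * w * w + A * w * w * (2 * T) * c1 + A * w * w * (T * T) * c2 + 0 * c3
  + 0 * c4 + 0 * c6.
Proof.
transitivity (
  A * w * w + A * w * w * (2 * T) * c1 + A * w * w * (T * T) * c2 + 0 * c3
  + 0 * c4 + 0 * c6
  + (A * w * w * (2 * T * c1 + T * T + 1)) * (c1 * c1 - (c2 + 1) / 2)
  + (A * w * w * (1 - T * T + 2 * T * c1)) * (s1 * s1 - (1 - c2) / 2)).
  by field.
by rewrite C11 S11 !subrr !mulr0 !addr0.
Qed.

End TrigonometricIdentities.

Section Values.
Context {R : realType} {n : nat} (i0 i1 : 'I_n).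
Hypothesis lt01 : (i0 < i1)%N.
Implicit Types (x : 'rV[R]_n).

Local Notation D := (pderiv i0).
Local Notation om := (twopi R).
Local Notation L := (Lf i0 i1).
Local Notation C := (@cosk R n i0).
Local Notation S := (@sink R n i0).
Local Notation O := (fun _ : 'rV[R]_n => 0 : R).
Local Notation ell := (ell i0).
Local Notation liecomp := (liecomp i0).

Let C11 x : C 1 x * C 1 x = (C 2 x + 1) / 2.
Proof. by have := @cosk_cosk R n i0 1 1 x isT; rewrite subnn cosk0. Qed.
Let S11 x : S 1 x * S 1 x = (1 - C 2 x) / 2.
Proof. by have := @sink_sink R n i0 1 1 x isT; rewrite subnn cosk0. Qed.
Let S21 x : S 2 x * S 1 x = (C 1 x - C 3 x) / 2.
Proof. exact: (@sink_sink R n i0 2 1 x isT). Qed.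
Let C21 x : C 2 x * C 1 x = (C 3 x + C 1 x) / 2.
Proof. exact: (@cosk_cosk R n i0 2 1 x isT). Qed.
Let S22 x : S 2 x * S 2 x = (1 - C 4 x) / 2.
Proof. by have := @sink_sink R n i0 2 2 x isT; rewrite subnn cosk0. Qed.
Let C22 x : C 2 x * C 2 x = (C 4 x + 1) / 2.
Proof. by have := @cosk_cosk R n i0 2 2 x isT; rewrite subnn cosk0. Qed.
Let S1C1 x : S 1 x * C 1 x = S 2 x / 2.
Proof. by have := @sink_cosk R n i0 1 1 x isT; rewrite subnn sink0 addr0. Qed.
Let C2S1 x : C 2 x * S 1 x = (S 3 x - S 1 x) / 2.
Proof. exact: (@cosk_sink R n i0 2 1 x isT). Qed.
Let S31 x : S 3 x * S 1 x = (C 2 x - C 4 x) / 2.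
Proof. exact: (@sink_sink R n i0 3 1 x isT). Qed.
Let S33 x : S 3 x * S 3 x = (1 - C 6 x) / 2.
Proof. by have := @sink_sink R n i0 3 3 x isT; rewrite subnn cosk0. Qed.
Let C31 x : C 3 x * C 1 x = (C 4 x + C 2 x) / 2.
Proof. exact: (@cosk_cosk R n i0 3 1 x isT). Qed.
Let C33 x : C 3 x * C 3 x = (C 6 x + 1) / 2.
Proof. by have := @cosk_cosk R n i0 3 3 x isT; rewrite subnn cosk0. Qed.

(** * Curvature of [(t + e cos 2 theta) e_0] and [sin theta e_1] *)

Section Mixed.
Variables (a b c t e : R).
Hypothesis abc : admissible a b c.

Local Notation A2 := (symbol a b 2).
Local Notation B1 := (symbol a c 1).
Local Notation B3 := (symbol a c 3).
Let f : 'rV[R]_n -> R := fun x => t * C 0 x + e * C 2 x.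

Let xf : xfun i0 f. Proof. exact: (trig_xfun (trig_cc i0 t e 0 2)). Qed.

Let fE x : f x = t + e * C 2 x. Proof. by rewrite /f cosk0 mulr1. Qed.

Let DfE x : D f x = e * (- (2 * om) * S 2 x).
Proof. by rewrite (xderivE (xderiv_cc i0 t e 0 2)) sink0 !mulr0 add0r. Qed.

Let ellfE x : ell a b f x = t * a + e * (A2 * C 2 x).
Proof.
by rewrite ell_cc cosk0 /symbol mul0r expr0n mulr0 addr0 mulr1.
Qed.

Lemma koszul_mixed_ufu (H : R) :
  koszul a b c (L f O) (L (fun x => H * S 2 x) O) (L f O) =
  - 2 * om * H * (a * t * e + e * t * A2 / 2).
Proof.
have dh := xderivZ H (xderiv_sink i0 2); have xh : xfun i0 (fun x => H * S 2 x) by case: dh.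
rewrite (koszul_ufu lt01 a b c xf xh) -[RHS](torus_int_cospoly i0
  (- 2 * om * H * (a * t * e + e * t * A2 / 2)) 0
  (- 2 * om * H * (a * t * t + e * e * A2)) 0
  (- 2 * om * H * (e * t * A2 / 2)) 0).
congr torus_int; apply/funext => x.
rewrite (xderivE dh) DfE ellfE fE.
exact: (mixed_ufu_identity (C 1 x) (C 3 x) (C 6 x) (S22 x) (C22 x)).
Qed.

(** The field [r] is constrained only through [D r] and [ell a c r], which are all that the Koszul
    term sees; this admits the constant that [norm0] subtracts when [a = 0]. *)
Lemma koszul_mixed_vvu (r1 r3 : R) (r : 'rV[R]_n -> R) : xfun i0 r ->
  D r = D (fun x => r1 * C 1 x + r3 * C 3 x) ->
  ell a c r = ell a c (fun x => r1 * C 1 x + r3 * C 3 x) ->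
  koszul a b c (L O (S 1)) (L O r) (L f O) =
  om * e / 4 * (- 2 * B1 * r1 + (3 * B1 - B3) * r3) / 2.
Proof.
move=> xr dr er; rewrite (koszul_vvu lt01 a b c xf (xfun_sink i0 1) xr).
congr (_ / 2); rewrite -[RHS](torus_int_cospoly i0
  (om * e / 4 * (- 2 * B1 * r1 + (3 * B1 - B3) * r3)) 0
  (om / 2 * (B1 * ((t - e / 2) * (3 * r3) + e / 2 * r1 - (t - e / 2) * r1)
     - ((t + e / 2) * (r1 * B1) + (t + e / 2) * (r3 * B3) + e / 2 * (r1 * B1)))) 0
  (om / 2 * (- B1 * ((t - e / 2) * (3 * r3) + e / 2 * r1)
     - ((t + e / 2) * (r3 * B3) + e / 2 * (r1 * B1))))
  (om / 2 * (- B1 * (e / 2) * (3 * r3) - e / 2 * (r3 * B3)))).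
congr torus_int; apply/funext => x.
rewrite dr er (xderivE (xderiv_cc i0 r1 r3 1 3)) (xderivE (xderiv_sink i0 1)).
rewrite ell_cc ell_sink fE.
exact: (mixed_vvu_identity (C11 x) (S11 x) (C21 x) (C2S1 x) (S31 x) (S33 x)
  (C31 x) (C33 x)).
Qed.

(** Lets one evaluation serve two terms of the curvature: [sin theta e_1] is the first argument next
    to [nabla u v], but the second next to the bracket. *)
Lemma koszul_vvuC (g r : 'rV[R]_n -> R) : xfun i0 g -> xfun i0 r ->
  koszul a b c (L O g) (L O r) (L f O) = koszul a b c (L O r) (L O g) (L f O).
Proof.
move=> xg xr; rewrite (koszul_vvu lt01 a b c xf xg xr) (koszul_vvu lt01 a b c xf xr xg).
by congr (torus_int _ / 2); apply/funext => x; rewrite addrC.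
Qed.

Lemma sec_mixed : (a = 0 -> t + e = 0) ->
  sec_num a b c (L f O) (L O (S 1)) =
  om ^+ 2 * B1 * a * t * e / A2
  + e ^+ 2 * om ^+ 2 * (B1 / 16 - 3 * B3 / 32 + 9 * B1 ^+ 2 / (32 * B3)).
Proof.
move=> te0; case: (abc) => a0 b0 c0 ABC.
have A20 : A2 != 0.
  by apply: (@symbol_neq0 R a b 2) => //; move: ABC; case: (a == 0); case: (b == 0).
have B30 : B3 != 0.
  apply: (@symbol_neq0 R a c 3) => //.
  by move: ABC; case: (a == 0); case: (b == 0); case: (c == 0).
(* Fourier coefficients: [H] of [nabla v v], which is [H sin 2 theta e_0]; [r1], [r3] of [nabla u v]
   and [l1], [l3] of the bracket, both along [e_1]. Product-to-sum gives the frequencies, and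
   solving for a covariant derivative divides by the symbols [A2], [B1], [B3]. *)
pose H := - om * B1 / (2 * A2).
pose r1 := - om * t; pose r3 := - (om * e / 4) * (1 + 3 * B1 / B3).
pose l1 := - om * (t + e / 2); pose l3 := - om * e / 2.
pose r := fun x => r1 * C 1 x + r3 * C 3 x.
have xS := @xfun_sink R n i0 1.
have lE : liecomp f O O (S 1) = fun x => l1 * C 1 x + l3 * C 3 x.
  apply/funext => x; rewrite /liecomp mul0r sub0r fE (xderivE (xderiv_sink i0 1)).
  transitivity (- om * t * C 1 x - om * e * (C 2 x * C 1 x)).
    by cbv beta; generalize (C 1 x) (C 2 x) om; intros; ring.
  rewrite C21 /l1 /l3.
  by generalize (C 1 x) (C 3 x) om; intros; field.
have mE : (fun y => f y * ell a c (S 1) y) =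
    fun y => B1 * (t - e / 2) * S 1 y + B1 * (e / 2) * S 3 y.
  apply/funext => x; rewrite fE ell_sink.
  transitivity (B1 * t * S 1 x + B1 * e * (C 2 x * S 1 x)).
    by generalize (S 1 x) (C 2 x) B1; intros; ring.
  rewrite C2S1.
  by generalize (S 1 x) (S 3 x) B1; intros; field.
have tO := @trig_cst R n i0 0.
have f0 : a = 0 -> f 0 = 0 /\ O 0 = 0.
  by move=> /te0 te; rewrite fE cosk_at0 mulr1.
have E1 x : ell a b (fun x => H * S 2 x) x = koszul0 i0 a b c O (S 1) O (S 1) x / 2.
  rewrite koszul0_vv (ellZ a b H x (xfun_sink i0 2)) !ell_sink.
  rewrite (xderivE (xderiv_sink i0 1)).
  transitivity (- B1 * om * (S 1 x * C 1 x)); last first.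
    by generalize (S 1 x) (C 1 x) om; intros; field.
  rewrite S1C1 /H; move: A20.
  by generalize (S 2 x) A2 B1 om; intros; field.
have E2 x : ell a c O x = koszul1 i0 a c O (S 1) O (S 1) x / 2.
  by rewrite koszul1_vv ell_0 mul0r.
have E3 x : ell a b O x = koszul0 i0 a b c f O O (S 1) x / 2.
  by rewrite koszul0_uv ell_0 mul0r.
have E4 x : ell a c r x = koszul1 i0 a c f O O (S 1) x / 2.
  rewrite koszul1_uv lE mE (xderivE (xderiv_ss i0 _ _ 1 3)) !ell_cc.
  rewrite /r1 /r3 /l1 /l3; move: B30.
  by generalize (C 1 x) (C 3 x) B1 B3 om; intros; field.
rewrite (sec_num_Lf lt01 abc (trig_cc i0 t e 0 2) tO tO (trig_sink i0 1)
  (trigZ H (trig_sink i0 2)) tO tO (trig_cc i0 r1 r3 1 3) f0 E1 E2 E3 E4).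
have xr : xfun i0 r := trig_xfun (trig_cc i0 r1 r3 1 3).
have xl : xfun i0 (fun x => l1 * C 1 x + l3 * C 3 x) := trig_xfun (trig_cc i0 l1 l3 1 3).
(* [H sin 2 theta] already vanishes at the origin. The cosine polynomial [r] need not, and its
   correction stays in place. *)
rewrite !norm0_0 (@norm0_id _ _ _ (fun x => H * S 2 x)); last by rewrite sink_at0 mulr0.
rewrite liecomp0r lE koszul_mixed_ufu.
rewrite (koszul_mixed_vvu (r1 := r1) (r3 := r3) (xfun_norm0 a xr)
  (D_norm0 a xr) (ell_norm0 a c xr)).
rewrite (koszul_vvuC xl xS) (koszul_mixed_vvu (r1 := l1) (r3 := l3) xl)//.
rewrite /H /r1 /r3 /l1 /l3; move: A20 B30.
generalize A2 B1 B3 om => k2 m1 m3 w k0 m0; field.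
by rewrite k0 m0.
Qed.

End Mixed.

(** * Curvature among the fields [f e_0] when [a = 0] *)

Section Circle.
Variables (b c T : R).
Hypothesis abc : admissible 0 b c.

Local Notation A := (symbol 0 b 1).
Let F : 'rV[R]_n -> R := fun x => 1 * C 1 x + T * C 0 x.

Let xF : xfun i0 F. Proof. exact: (trig_xfun (trig_cc i0 1 T 1 0)). Qed.

Let xS : xfun i0 (S 1). Proof. exact: xfun_sink. Qed.

Let FE x : F x = C 1 x + T. Proof. by rewrite /F cosk0 mul1r mulr1. Qed.

Let DFE x : D F x = - om * S 1 x.
Proof.
by rewrite (xderivE (xderiv_cc i0 1 T 1 0)) sink0 !mulr0 addr0 !mul1r.
Qed.

Let DSE x : D (S 1) x = om * C 1 x.
Proof. by rewrite (xderivE (xderiv_sink i0 1)) mul1r. Qed.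

Let ellF : ell 0 b F = fun x => A * C 1 x.
Proof.
apply/funext => x; rewrite ell_cc {2}/symbol mul0r expr0n mulr0 addr0 mul0r mulr0.
by rewrite addr0 mul1r.
Qed.

Let ellS : ell 0 b (S 1) = fun x => A * S 1 x.
Proof. by apply/funext => x; rewrite ell_sink. Qed.

Let DAF x : D (fun x => A * C 1 x) x = - om * A * S 1 x.
Proof.
rewrite (xderivE (xderivZ A (xderiv_cosk i0 1))) mul1r.
by generalize (S 1 x) A om; intros; ring.
Qed.

Let DAS x : D (fun x => A * S 1 x) x = om * A * C 1 x.
Proof.
rewrite (xderivE (xderivZ A (xderiv_sink i0 1))) mul1r.
by generalize (C 1 x) A om; intros; ring.
Qed.

(** The two fields are orthogonal with squared norm [b * om ^+ 2 / 2] each, so the normalised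
    curvature is [1 / (4 b)]. All terms in [T] have mean zero. *)
Lemma sec_circle : sec_num 0 b c (L (S 1) O) (L F O) = b * om ^+ 4 / 16.
Proof.
(* At frequency [2] half the Koszul density has coefficient [- 3 / 2 * om * A], and the symbol there
   is [4 * A]. The constant [- P] in [p2] below makes it vanish at the origin. *)
pose P := - (3 / 8) * om.
pose p1 := fun x => om * T * S 1 x + 3 / 8 * om * S 2 x.
pose p2 := fun x => P * C 2 x + - P * C 0 x.
have xAC := xfunM (xfun_cst i0 A) (@xfun_cosk R n i0 1).
have xAS := xfunM (xfun_cst i0 A) (@xfun_sink R n i0 1).
have lFF : liecomp F F F F = O.
  by apply/funext => x; rewrite /liecomp subrr.
have lE : liecomp (S 1) (S 1) F F = fun x => om * C 0 x + om * T * C 1 x.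
  apply/funext => x; rewrite /liecomp FE DFE DSE cosk0.
  transitivity (om * (C 1 x * C 1 x) + om * T * C 1 x + om * (S 1 x * S 1 x)).
    by generalize (C 1 x) (S 1 x) om; intros; ring.
  rewrite C11 S11.
  by generalize (C 1 x) (C 2 x) om; intros; field.
have tO := @trig_cst R n i0 0.
have E1 x : ell 0 b p1 x = koszul0 i0 0 b c F O F O x / 2.
  rewrite koszul0_uu lFF ell_0 ellF ell_ss (pderivM i0 xF.1 xAC.1) DFE DAF FE.
  transitivity (3 * om * A * (S 1 x * C 1 x) + om * A * T * S 1 x); last first.
    by generalize (S 1 x) (C 1 x) A om; intros; field.
  rewrite S1C1 /symbol.
  by generalize (S 1 x) (S 2 x) om; intros; field.
have E2 (q : R) x : ell q c O x = koszul1 i0 q c F O F O x / 2.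
  by rewrite koszul1_uu ell_0 mul0r.
have E3 x : ell 0 b p2 x = koszul0 i0 0 b c (S 1) O F O x / 2.
  rewrite koszul0_uu lE ellF ellS !ell_cc (pderivM i0 xF.1 xAS.1) (pderivM i0 xS.1 xAC.1).
  rewrite DFE DAF DAS DSE FE.
  transitivity (3 / 2 * A * om * (S 1 x * S 1 x) - 3 / 2 * A * om * (C 1 x * C 1 x));
    last first.
    by rewrite /symbol; generalize (S 1 x) (C 1 x) (C 0 x) om; intros; field.
  rewrite C11 S11 /P /symbol.
  by generalize (C 2 x) (C 0 x) om; intros; field.
have E4 (q : R) x : ell q c O x = koszul1 i0 q c (S 1) O F O x / 2.
  by rewrite koszul1_uu ell_0 mul0r.
have f0 : 0 = 0 :> R -> S 1 0 = 0 /\ O 0 = 0 by rewrite sink_at0.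
rewrite (sec_num_Lf lt01 abc (trig_sink i0 1) tO (trig_cc i0 1 T 1 0) tO
  (trig_ss i0 (om * T) (3 / 8 * om) 1 2) tO (trig_cc i0 P (- P) 2 0) tO f0 E1 (E2 0) E3 (E4 0)).
rewrite !norm0_0 (@norm0_id _ _ _ p1); last by rewrite /p1 !sink_at0 !mulr0 addr0.
rewrite (@norm0_id _ _ _ p2); last by rewrite /p2 !cosk_at0 !mulr1 subrr.
rewrite liecomp00 lE.
have xp1 : xfun i0 p1 := trig_xfun (trig_ss i0 (om * T) (3 / 8 * om) 1 2).
have xp2 : xfun i0 p2 := trig_xfun (trig_cc i0 P (- P) 2 0).
have xl : xfun i0 (fun x => om * C 0 x + om * T * C 1 x) :=
  trig_xfun (trig_cc i0 om (om * T) 0 1).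
rewrite (koszul_ufu lt01 0 b c xS xp1) (koszul_uuu lt01 0 b c xF xp2 xS).
rewrite (koszul_uuu lt01 0 b c xl xF xS).
have -> : (fun x => ell 0 b (S 1) x * (p1 x * D (S 1) x - S 1 x * D p1 x)) =
    (fun x => A * om * om * (9 / 32) + 0 * C 1 x + A * om * om * (- 3 / 8) * C 2 x
      + 0 * C 3 x + A * om * om * (3 / 32) * C 4 x + 0 * C 6 x).
  apply/funext => x; rewrite ellS (xderivE (xderiv_ss i0 _ _ 1 2)).
  rewrite (xderivE (xderiv_sink i0 1)).
  exact: (circle_ufu_identity (C 3 x) (C 6 x) (S11 x) (S22 x) (C22 x) (S1C1 x)).
rewrite torus_int_cospoly.
have -> : (fun x => ell 0 b (S 1) x * (p2 x * D F x - F x * D p2 x)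
      - ell 0 b F x * (S 1 x * D p2 x - p2 x * D (S 1) x)
      + ell 0 b p2 x * (F x * D (S 1) x - S 1 x * D F x)) =
    (fun x => A * om * P * (3 / 2) + A * om * P * (3 * T) * C 1 x + A * om * P * 3 * C 2 x
      + A * om * P * T * C 3 x + A * om * P * (- 1 / 2) * C 4 x + 0 * C 6 x).
  apply/funext => x; rewrite -(circle_vwu_identity (C 6 x) (C11 x) (S11 x) (S21 x)
    (C21 x) (S22 x) (C22 x) (S1C1 x)).
  rewrite ellS ellF !ell_cc (xderivE (xderiv_cc i0 P (- P) 2 0)) DFE DSE FE /p2 cosk0 sink0.
  by rewrite /symbol; generalize (C 1 x) (C 2 x) (S 1 x) (S 2 x) om; intros; field.
rewrite torus_int_cospoly.
have -> : (fun x =>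
      ell 0 b (S 1) x * (F x * D (fun x => om * C 0 x + om * T * C 1 x) x
        - (om * C 0 x + om * T * C 1 x) * D F x)
      - ell 0 b (fun x => om * C 0 x + om * T * C 1 x) x * (S 1 x * D F x - F x * D (S 1) x)
      + ell 0 b F x * ((om * C 0 x + om * T * C 1 x) * D (S 1) x
        - S 1 x * D (fun x => om * C 0 x + om * T * C 1 x) x)) =
    (fun x => A * om * om + A * om * om * (2 * T) * C 1 x + A * om * om * (T * T) * C 2 x
      + 0 * C 3 x + 0 * C 4 x + 0 * C 6 x).
  apply/funext => x; rewrite -(circle_lvu_identity (C 3 x) (C 4 x) (C 6 x) (C11 x) (S11 x)).
  rewrite ellS ellF !ell_cc (xderivE (xderiv_cc i0 om (om * T) 0 1)) DFE DSE FE cosk0 sink0.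
  by rewrite /symbol; generalize (C 1 x) (S 1 x) om; intros; ring.
(* In units of [A * om ^+ 2] the three terms give [9 / 32 + 9 / 32 - 1 / 2 = 1 / 16], and
   [A = b * om ^+ 2]. *)
rewrite torus_int_cospoly /P /symbol.
by generalize om; intros; field.
Qed.

End Circle.
End Values.

(** * Both signs of the sectional curvature *)

Lemma quadratic_both_signs (R : realType) (k q : R) : 0 < k ->
  (exists e, 0 < k * e + e ^+ 2 * q) /\ (exists e, k * e + e ^+ 2 * q < 0).
Proof.
(* Since [e * (|q| + 1) = k], both [k + e * q] and [k - e * q] are at least [e]: the linear term
   wins for either sign of [q]. *)
move=> k0; pose e := k / (`|q| + 1).
have q0 := normr_ge0 q; have q1 : 0 < `|q| + 1 by lra.
have e0 : 0 < e by rewrite divr_gt0.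
have ek : e * (`|q| + 1) = k by rewrite divfK// gt_eqF.
have [l1 l2] : - `|q| <= q /\ q <= `|q| by split; [rewrite lerNl -normrN|]; exact: ler_norm.
split; [exists e|exists (- e)].
  rewrite (_ : k * e + _ = e * (k + e * q)); last by ring.
  by rewrite mulr_gt0// -ek -mulrDr mulr_gt0//; lra.
rewrite (_ : k * - e + _ = - (e * (k - e * q))); last by ring.
by rewrite oppr_lt0 mulr_gt0// -ek -mulrBr mulr_gt0//; lra.
Qed.

Theorem theorem7p1 (R : realType) (n : nat) (a b c : R) :
  (2 <= n)%N -> 0 <= a -> 0 <= b -> 0 <= c ->
  [|| (a != 0) && (b != 0), (a != 0) && (c != 0) | (b != 0) && (c != 0)] ->
  (exists u v : vf R n, in_liealg a u /\ in_liealg a v /\ 0 < sec_num a b c u v) /\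
  (exists u v : vf R n, in_liealg a u /\ in_liealg a v /\ sec_num a b c u v < 0).
Proof.
move=> n2 a0 b0 c0 abc.
have adm : admissible a b c by split.
pose i0 : 'I_n := Ordinal (ltnW n2); pose i1 : 'I_n := Ordinal n2.
have lt01 : (i0 < i1)%N by [].
have w0 := twopi_gt0 R.
have xO := @xfun_cst R n i0 0; have xS := @xfun_sink R n i0 1.
have xcc s t k l := trig_xfun (@trig_cc R n i0 s t k l).
have lv : in_liealg a (Lf i0 i1 (fun _ => 0) (@sink R n i0 1)).
  by apply: (in_liealg_Lf lt01 xO xS) => _; rewrite sink_at0.
have [az|an] := eqVneq a 0; last first.
  have lu t e : in_liealg a (Lf i0 i1 (fun x => t * cosk i0 0 x + e * cosk i0 2 x) (fun _ => 0)).
    by apply: (in_liealg_Lf lt01 (xcc t e 0%N 2%N) xO) => az; rewrite az eqxx in an.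
  have sec e := @sec_mixed R n i0 i1 lt01 a b c 1 e adm.
  have pos (d : R) k : 0 <= d -> 0 < symbol a d k.
    by move=> d0; rewrite ltr_pwDl ?lt0r ?an// mulr_ge0// sqr_ge0.
  (* The sign of [Q] varies with [a] and [c], which is why the linear coefficient [k > 0] has to
     decide. *)
  pose Q := twopi R ^+ 2 * (symbol a c 1 / 16 - 3 * symbol a c 3 / 32
    + 9 * symbol a c 1 ^+ 2 / (32 * symbol a c 3)).
  pose k := twopi R ^+ 2 * symbol a c 1 * a / symbol a b 2.
  have k0 : 0 < k by rewrite divr_gt0 ?mulr_gt0 ?exprn_gt0 ?pos// lt0r an.
  have secE e : sec_num a b c
      (Lf i0 i1 (fun x => 1 * cosk i0 0 x + e * cosk i0 2 x) (fun _ => 0))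
      (Lf i0 i1 (fun _ => 0) (@sink R n i0 1)) = k * e + e ^+ 2 * Q.
    rewrite sec; last by move=> az; rewrite az eqxx in an.
    rewrite /k /Q; generalize (twopi R) (symbol a c 1) (symbol a c 3)
      (symbol a b 2)^-1 (32 * symbol a c 3)^-1; intros; ring.
  have [[e1 E1] [e2 E2]] := quadratic_both_signs Q k0.
  split.
    exists (Lf i0 i1 (fun x => 1 * cosk i0 0 x + e1 * cosk i0 2 x) (fun _ => 0)).
    exists (Lf i0 i1 (fun _ => 0) (@sink R n i0 1)).
    by split; [exact: lu|split; [exact: lv|rewrite secE]].
  exists (Lf i0 i1 (fun x => 1 * cosk i0 0 x + e2 * cosk i0 2 x) (fun _ => 0)).
  exists (Lf i0 i1 (fun _ => 0) (@sink R n i0 1)).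
  by split; [exact: lu|split; [exact: lv|rewrite secE]].
move: abc adm lv; rewrite {a a0}az eqxx /= => /andP[bn cn] adm lv.
have bp : 0 < b by rewrite lt0r bn.
have cp : 0 < c by rewrite lt0r cn.
split.
  exists (Lf i0 i1 (@sink R n i0 1) (fun _ => 0)).
  (* [T = -1] makes the cosine field vanish at the origin. *)
  exists (Lf i0 i1 (fun x => 1 * cosk i0 1 x + -1 * cosk i0 0 x) (fun _ => 0)).
  split; first by apply: (in_liealg_Lf lt01 xS xO) => _; rewrite sink_at0.
  split.
    apply: (in_liealg_Lf lt01 (xcc 1 (-1) 1%N 0%N) xO) => _.
    by rewrite !cosk_at0 !mulr1 subrr.
  by rewrite (sec_circle lt01 (-1) adm) divr_gt0// mulr_gt0// exprn_gt0.
(* [t = -1] and [e = 1], so that the field vanishes at the origin. *)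
exists (Lf i0 i1 (fun x => -1 * cosk i0 0 x + 1 * cosk i0 2 x) (fun _ => 0)).
exists (Lf i0 i1 (fun _ => 0) (@sink R n i0 1)).
split.
  apply: (in_liealg_Lf lt01 (xcc (-1) 1 0%N 2%N) xO) => _.
  by rewrite !cosk_at0 !mulr1 addNr.
split=> //; rewrite (sec_mixed lt01 adm); last by rewrite addNr.
have -> : forall s, twopi R ^+ 2 * s * 0 * -1 * 1 / symbol 0 b 2 = 0.
  by move=> s; rewrite mulr0 !mul0r.
(* For [a = 0] the symbol at frequency [3] is nine times that at frequency [1], and
   [1 / 16 - 27 / 32 + 1 / 32 = - 3 / 4]. *)
rewrite (_ : _ + _ = - (3 / 4 * c * twopi R ^+ 4)).
  by rewrite oppr_lt0 !mulr_gt0// exprn_gt0.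
rewrite /symbol; move: (twopi R) w0 => w w0.
have wn : w != 0 by rewrite gt_eqF.
by field; rewrite ?cn ?wn.
Qed.
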